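(* Let $R$ be the coefficient defined in the context. Then $R$ has symmetries under the action of the group $\tilde G$ (which has $96$ elements): for every $\tilde\sigma\in\tilde G$ and every $(k,l,m)\in\mathbb{Z}^3$ there exist $\alpha_1,\dots,\alpha_s\in S_{abc}$ and $n_1,\dots,n_{s+3}\in\mathbb{Z}$ such that $$R(k,l,m;a,b,c;x)=(\alpha_1)_{n_1}\cdots(\alpha_s)_{n_s}(-1)^{n_{s+1}}x^{n_{s+2}}(1-x)^{n_{s+3}}\,(\tilde\sigma R)(k,l,m;a,b,c;x).$$ In fact, for all $(k,l,m)\in\mathbb{Z}^3$: $$R(k,l,m;a,b,c;x)=\frac{(c+1)_{m-1}(c)_{m-1}(-1)^{m-k-l}x^{1-m}(1-x)^{m+1-k-l}}{(a+1)_{k-1}(b+1)_{l-1}(c-a)_{m-k}(c-b)_{m-l}}\,(\tilde\sigma_0R)(k,l,m;a,b,c;x),$$ $$R(k,l,m;a,b,c;x)=(1-x)^{-l}(\tilde\sigma_1R)(k,l,m;a,b,c;x),$$ $$R(k,l,m;a,b,c;x)=\frac{(c)_m(c-a-b)_{m-k-l}}{(c-a)_{m-k}(c-b)_{m-l}}(\tilde\sigma_2R)(k,l,m;a,b,c;x),$$ $$R(k,l,m;a,b,c;x)=(\tilde\sigma_3R)(k,l,m;a,b,c;x).$$ (Each $\tilde\sigma_i$ is an involution, so $(\tilde\sigma_iR)(\vec z)=R(\tilde\sigma_i\vec z)$; e.g. $(\tilde\sigma_0R)(k,l,m;a,b,c;x)=R(2-k,2-l,2-m;a+k-1,b+l-1,c+m-1;x)$,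 $(\tilde\sigma_1R)(k,l,m;a,b,c;x)=R(m+1-k,l,m;c-a-1,b,c;\tfrac{x}{x-1})$, $(\tilde\sigma_2R)(k,l,m;a,b,c;x)=R(k,l,k+l-m;a,b,a+b+1-c;1-x)$, $(\tilde\sigma_3R)(k,l,m;a,b,c;x)=R(l,k,m;b,a,c;x)$.)
   Context: $F(a,b,c;x)=\sum_{n\ge0}\frac{(a)_n(b)_n}{(c)_n n!}x^n$, $(\alpha)_n=\Gamma(\alpha+n)/\Gamma(\alpha)$ for $n\in\mathbb{Z}$. Standing assumption: $a,b,c-a,c-b,c,c-a-b,a-b\notin\mathbb{Z}$. For each $(k,l,m)\in\mathbb{Z}^3$ there is a unique pair $(Q,R)$ of rational functions of $a,b,c,x$ with $F(a+k,b+l,c+m;x)=Q\,F(a+1,b+1,c+1;x)+R\,F(a,b,c;x)$; write $R=R(k,l,m;a,b,c;x)$, and $R(k,l,m;\alpha_1,\alpha_2,\alpha_3;\beta)$ for the substitution $a,b,c,x\mapsto\alpha_1,\alpha_2,\alpha_3,\beta$. Let $S_{abc}=\{n_0+n_1a+n_2b+n_3c:n_i\in\mathbb{Z}\}$, $S_x=\{x,\frac{x}{x-1},1-x,\frac{x-1}{x},\frac1x,\frac1{1-x}\}$, $S=\{(k,l,m;\alpha_1,\alpha_2,\alpha_3;\beta):(k,l,m)\in\mathbb{Z}^3,\alpha_i\in S_{abc},\beta\in S_x\}$, $T$ the rational functions of $a,b,c,x$, $\mathrm{Map}(S,T)$ the functions $S\to T$. Let $\tilde G$ be the group (under composition) of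 maps $S\to S$ generated by $\tilde\sigma_0:(k,l,m;a,b,c;x)\mapsto(2-k,2-l,2-m;a+k-1,b+l-1,c+m-1;x)$, $\tilde\sigma_1:(k,l,m;a,b,c;x)\mapsto(m+1-k,l,m;c-a-1,b,c;\frac{x}{x-1})$, $\tilde\sigma_2:(k,l,m;a,b,c;x)\mapsto(k,l,k+l-m;a,b,a+b+1-c;1-x)$, $\tilde\sigma_3:(k,l,m;a,b,c;x)\mapsto(l,k,m;b,a,c;x)$, acting on $\mathrm{Map}(S,T)$ by $(\tilde\sigma P)(\vec z)=P(\tilde\sigma^{-1}\vec z)$. *)

(* Defs.v *)
From HB Require Import structures.
From mathcomp Require Import all_boot all_order all_algebra.
From Stdlib Require Import ClassicalEpsilon.
Set Implicit Arguments. Unset Strict Implicit. Unset Printing Implicit Defensive.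
Import Order.TTheory GRing.Theory Num.Theory.
Local Open Scope ring_scope.

Notation ratfun K := {fraction {poly K}}.

Definition cstF (K : fieldType) (c : K) : ratfun K := FracField.tofrac (c%:P).
Definition varX (K : fieldType) : ratfun K := FracField.tofrac ('X : {poly K}).

(* Pochhammer symbol (al)_n = Gamma(al+n)/Gamma(al) for n in Z:
   (al)_n = al(al+1)...(al+n-1) for n >= 0,
   (al)_{-j} = 1/((al-1)(al-2)...(al-j)) for j > 0  (Negz j = -(j+1)). *)
Definition poch (K : fieldType) (al : K) (n : int) : K :=
  match n with
  | Posz j => \prod_(i < j) (al + i%:R)
  | Negz j => (\prod_(i < j.+1) (al - (i.+1)%:R))^-1
  end.

Definition hypF (K : fieldType) (a b c : K) (n : nat) : K :=
  poch a n * poch b n / (poch c n * (n`!)%:R).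

Definition pmulS (K : fieldType) (p : {poly K}) (f : nat -> K) (n : nat) : K :=
  \sum_(i < n.+1) p`_i * f (n - i)%N.

(* (Q,R) in K(x)^2 satisfies
     F(a+k,b+l,c+m;x) = Q F(a+1,b+1,c+1;x) + R F(a,b,c;x)
   as an identity of formal (Laurent) series; written with a common
   denominator d : Q = q/d, R = r/d, d * F_{klm} = q * F_{111} + r * F_{000}. *)
Definition contig_rel (K : fieldType) (k l m : int) (a b c : K)
    (Q R : ratfun K) : Prop :=
  exists q r d : {poly K},
    [/\ d != 0, Q = FracField.tofrac q / FracField.tofrac d,
        R = FracField.tofrac r / FracField.tofrac d &
        forall n : nat,
          pmulS d (hypF (a + k%:~R) (b + l%:~R) (c + m%:~R)) n =
          pmulS q (hypF (a + 1) (b + 1) (c + 1)) n + pmulS r (hypF a b c) n].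

Definition Rcoef (K : fieldType) (k l m : int) (a b c : K) : ratfun K :=
  epsilon (inhabits 0) (fun R : ratfun K =>
    exists Q, contig_rel k l m a b c Q R /\
      forall Q' R', contig_rel k l m a b c Q' R' -> Q' = Q /\ R' = R).

Definition fsubst (K : fieldType) (beta f : ratfun K) : ratfun K :=
  let pq := epsilon (inhabits ((0 : {poly K}), (1 : {poly K})))
     (fun pq : {poly K} * {poly K} =>
        pq.2 != 0 /\ f = FracField.tofrac pq.1 / FracField.tofrac pq.2) in
  (map_poly (@cstF K) pq.1).[beta] / (map_poly (@cstF K) pq.2).[beta].

Definition notInt (K : fieldType) (y : K) : Prop := forall n : int, y != n%:~R.
Definition standing (K : fieldType) (a b c : K) : Prop :=
  notInt a /\ notInt b /\ notInt (c - a) /\ notInt (c - b) /\ notInt c /\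
  notInt (c - a - b) /\ notInt (a - b).

Record Sabc := mkSabc { n0 : int; n1 : int; n2 : int; n3 : int }.
Definition saddS (u v : Sabc) : Sabc :=
  mkSabc (n0 u + n0 v) (n1 u + n1 v) (n2 u + n2 v) (n3 u + n3 v).
Definition soppS (u : Sabc) : Sabc := mkSabc (- n0 u) (- n1 u) (- n2 u) (- n3 u).
Definition sconst (n : int) : Sabc := mkSabc n 0 0 0.
Definition sA : Sabc := mkSabc 0 1 0 0.
Definition sB : Sabc := mkSabc 0 0 1 0.
Definition sC : Sabc := mkSabc 0 0 0 1.
Definition evalabc (K : fieldType) (a b c : K) (u : Sabc) : K :=
  (n0 u)%:~R + a *~ n1 u + b *~ n2 u + c *~ n3 u.

Inductive Sx := Sx_x | Sx_xx1 | Sx_1mx | Sx_x1x | Sx_inv | Sx_inv1mx.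

Definition evalSx (K : fieldType) (s : Sx) : ratfun K :=
  let X := varX K in
  match s with
  | Sx_x => X
  | Sx_xx1 => X / (X - 1)
  | Sx_1mx => 1 - X
  | Sx_x1x => (X - 1) / X
  | Sx_inv => X^-1
  | Sx_inv1mx => (1 - X)^-1
  end.

(* beta |-> beta/(beta-1) on S_x *)
Definition sx_div (s : Sx) : Sx :=
  match s with
  | Sx_x => Sx_xx1 | Sx_xx1 => Sx_x | Sx_1mx => Sx_x1x
  | Sx_x1x => Sx_1mx | Sx_inv => Sx_inv1mx | Sx_inv1mx => Sx_inv
  end.
(* beta |-> 1-beta on S_x *)
Definition sx_1m (s : Sx) : Sx :=
  match s with
  | Sx_x => Sx_1mx | Sx_xx1 => Sx_inv1mx | Sx_1mx => Sx_x
  | Sx_x1x => Sx_inv | Sx_inv => Sx_x1x | Sx_inv1mx => Sx_xx1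
  end.

Record Spt := mkS { sk : int; sl : int; sm : int;
                    s1 : Sabc; s2 : Sabc; s3 : Sabc; sx : Sx }.

Definition sig0 (z : Spt) : Spt :=
  mkS (2 - sk z) (2 - sl z) (2 - sm z)
      (saddS (s1 z) (sconst (sk z - 1))) (saddS (s2 z) (sconst (sl z - 1)))
      (saddS (s3 z) (sconst (sm z - 1))) (sx z).
Definition sig1 (z : Spt) : Spt :=
  mkS (sm z + 1 - sk z) (sl z) (sm z)
      (saddS (saddS (s3 z) (soppS (s1 z))) (sconst (-1))) (s2 z) (s3 z)
      (sx_div (sx z)).
Definition sig2 (z : Spt) : Spt :=
  mkS (sk z) (sl z) (sk z + sl z - sm z) (s1 z) (s2 z)
      (saddS (saddS (saddS (s1 z) (s2 z)) (sconst 1)) (soppS (s3 z)))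
      (sx_1m (sx z)).
Definition sig3 (z : Spt) : Spt :=
  mkS (sl z) (sk z) (sm z) (s2 z) (s1 z) (s3 z) (sx z).

Inductive Gt : (Spt -> Spt) -> Prop :=
  | Gt_sig0 : Gt sig0
  | Gt_sig1 : Gt sig1
  | Gt_sig2 : Gt sig2
  | Gt_sig3 : Gt sig3
  | Gt_id : Gt id
  | Gt_comp f g : Gt f -> Gt g -> Gt (f \o g)
  | Gt_inv f g : Gt f -> cancel f g -> cancel g f -> Gt g.

(* R as an element of Map(S,T) (a,b,c fixed in K):
   R(k,l,m;al1,al2,al3;beta) = R(k,l,m;a,b,c;x)|_{a,b,c,x := al1,al2,al3,beta} *)
Definition Rmap (K : fieldType) (a b c : K) (z : Spt) : ratfun K :=
  fsubst (evalSx K (sx z))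
    (Rcoef (sk z) (sl z) (sm z)
       (evalabc a b c (s1 z)) (evalabc a b c (s2 z)) (evalabc a b c (s3 z))).

(* action of sigma on Map(S,T): (sigma P)(z) = P(sigma^{-1} z),
   where sinv is the inverse of sigma *)
Definition actG (T : Type) (sinv : Spt -> Spt) (P : Spt -> T) : Spt -> T :=
  fun z => P (sinv z).

Definition z0 (k l m : int) : Spt := mkS k l m sA sB sC Sx_x.

(* Main.v *)
Require Import Defs.
From HB Require Import structures.
From mathcomp Require Import all_boot all_order all_algebra.
From mathcomp Require Import ring zify.
From Stdlib Require Import ClassicalEpsilon FunctionalExtensionality.
Set Implicit Arguments. Unset Strict Implicit. Unset Printing Implicit Defensive.
Import Order.TTheory GRing.Theory Num.Theory.
Local Open Scope ring_scope.

(** The series [F(a+k, b+l, c+m; x)] satisfy contiguity relations that express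
    a unit shift of one parameter by an invertible 2x2 matrix acting on the pair
    [F(a, b, c; x)], [F(a+1, b+1, c+1; x)]. These two series are linearly
    independent over [K(x)], so the coefficients [Q], [R] satisfy the same
    relations in [(k, l, m)], and a family satisfying them is determined by its
    values at [(0,0,0)] and [(1,1,1)], where [R] is [1] and [0].

    The symmetries for [sig1], [sig2], [sig3] hold because the transformed
    coefficient, times its prefactor (Pfaff's transformation, respectively the
    connection coefficient between [0] and [1]), again satisfies these relations
    with the same initial values. The symmetry for [sig0] is Cramer's rule: the
    determinant of the shift by [(k-1, l-1, m-1)] is multiplicative in the shift,
    hence explicitly known. *)

(** * Contiguous families *)

(** The obstacle is [sig2]: a formal power series at 0 cannot be re-expanded at [1 - x], so this
    symmetry is not read off from a transformation of the series. The relations of a contiguous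
    family are algebraic in [x]; they are therefore stated over an arbitrary field, with [x] any of
    its elements, and survive every substitution that is a ring morphism fixing [K]. The six
    elements of S_x give such morphisms because they are transcendental over [K]. The theorem fixes
    the Pochhammer data and the exponents before the field and the parameters, so along a word in
    the generators a prefactor has to be carried as uniform data and not as an element of K(x). *)

Lemma int_ind_iff (P : int -> Prop) :
  P 0 -> (forall n, P n <-> P (n + 1)) -> forall n, P n.
Proof.
move=> P0 PS; elim/int_ind => [//|n IH|n IH].
  by rewrite intS addrC; apply: (PS _).1.
by apply: (PS _).2; rewrite intS opprD addrC addNKr.
Qed.

(** The last hypothesis steps down in [m] because the contiguity relation for [c] lowers it. The
    shift matrices being invertible, each step is an equivalence, which covers both directions in
    Z. *)
Lemma int3_ind_iff (P : int -> int -> int -> Prop) :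
  P 0 0 0 -> (forall k l m, P k l m <-> P (k + 1) l m) ->
  (forall k l m, P k l m <-> P k (l + 1) m) ->
  (forall k l m, P k l m <-> P k l (m - 1)) -> forall k l m, P k l m.
Proof.
move=> P0 P1 P2 P3 k l m.
elim/int_ind_iff: k => [|k]; last exact: P1.
elim/int_ind_iff: l => [|l]; last exact: P2.
elim/int_ind_iff: m => [//|m].
by rewrite -{1}(addrK 1 m) -P3.
Qed.

Lemma intr_succ (R : pzRingType) (n : int) : (n + 1)%:~R = n%:~R + 1 :> R.
Proof. by rewrite intrD. Qed.

Lemma intr_pred (R : pzRingType) (n : int) : (n - 1)%:~R = n%:~R - 1 :> R.
Proof. by rewrite intrB. Qed.

(** * Pochhammer symbols with integer index *)

Section Pochhammer.
Variable F : fieldType.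
Implicit Types (al : F) (n : int).

Lemma notInt_neq0 al n : notInt al -> al + n%:~R != 0.
Proof. by move=> h; rewrite addr_eq0 -mulrNz. Qed.

Lemma notIntD al n : notInt al -> notInt (al + n%:~R).
Proof. by move=> h i; rewrite -(inj_eq (addIr (- n%:~R))) addrK -intrB. Qed.

Lemma notIntN al : notInt al -> notInt (- al).
Proof. by move=> h i; rewrite eqr_oppLR -mulrNz. Qed.

(** For negative [n] the recursion cancels the last factor of the denominator, which is nonzero
    because [al] is not an integer. *)
Lemma poch_succ al n : notInt al -> poch al (n + 1) = poch al n * (al + n%:~R).
Proof.
move=> h; case: n => n; first by rewrite -PoszD addn1 /= big_ord_recr.
have nz i : al - i%:R != 0 by have := notInt_neq0 (- (i : int)) h; rewrite mulrNz.
rewrite NegzE; case: n => [|n].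
  by rewrite addNr /= big_ord0 big_ord1 mulVf // nz.
have -> : - (n.+2 : int) + 1 = - (n.+1 : int) by lia.
rewrite mulrNz -!NegzE /= [in RHS]big_ord_recr /=.
by rewrite invfM -mulrA mulVf ?mulr1 // nz.
Qed.

Lemma poch_pred al n : notInt al -> poch al (n - 1) = poch al n / (al + n%:~R - 1).
Proof.
move=> h; have := poch_succ (n - 1) h; rewrite subrK => ->.
by rewrite intrB addrA mulfK // -addrA -intr_pred notInt_neq0.
Qed.

Lemma poch0 al : poch al 0 = 1. Proof. exact: big_ord0. Qed.

Lemma poch_neq0 al n : notInt al -> poch al n != 0.
Proof.
move=> h; elim/int_ind_iff: n => [|n]; first by rewrite poch0 oner_neq0.
by rewrite poch_succ // mulf_eq0 negb_or notInt_neq0 // andbT.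
Qed.

(** Turns the denominators of the explicit formulas into Pochhammer symbols, as the general form of
    the symmetry requires. *)
Lemma pochV al n : notInt al -> (poch al n)^-1 = poch (al + n%:~R) (- n).
Proof.
move=> h.
suff e : poch al n * poch (al + n%:~R) (- n) = 1.
  by rewrite -[RHS](mulKf (poch_neq0 n h)) e mulr1.
(* Only the index [- n] is wanted, but induction needs the addition law at a general index [i]. *)
pose Q n i := poch al n * poch (al + n%:~R) i = poch al (n + i).
suff: Q n (- n) by rewrite /Q subrr poch0.
move: (- n); elim/int_ind_iff => [|i]; first by rewrite /Q poch0 mulr1 addr0.
rewrite /Q addrA !poch_succ //; last exact: notIntD.
rewrite intrD addrA mulrA; split=> [-> //|].
by apply: mulIf; rewrite -addrA -intrD notInt_neq0.
Qed.

End Pochhammer.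

(* The relations satisfied by [G k l m = F(a+k, b+l, c+m; x)]: shifting one
   parameter by one (by minus one for [c]) acts on the pair
   [(G k l m, G (k+1) (l+1) (m+1))] by an explicit invertible matrix. *)
Record contiguous (F : fieldType) (a b c x : F) (G : int -> int -> int -> F) : Prop :=
  Contiguous {
  contig_a (k l m : int) : G (k + 1) l m =
    G k l m + (b + l%:~R) / (c + m%:~R) * x * G (k + 1) (l + 1) (m + 1);
  contig_a1 (k l m : int) : (a + k%:~R + 1) * (1 - x) * G (k + 2) (l + 1) (m + 1) =
    (c + m%:~R) * G k l m +
    (a + k%:~R + 1 - (c + m%:~R) + (b + l%:~R) * x) * G (k + 1) (l + 1) (m + 1);
  contig_b (k l m : int) : G k (l + 1) m =
    G k l m + (a + k%:~R) / (c + m%:~R) * x * G (k + 1) (l + 1) (m + 1);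
  contig_b1 (k l m : int) : (b + l%:~R + 1) * (1 - x) * G (k + 1) (l + 2) (m + 1) =
    (c + m%:~R) * G k l m +
    (b + l%:~R + 1 - (c + m%:~R) + (a + k%:~R) * x) * G (k + 1) (l + 1) (m + 1);
  contig_c (k l m : int) : G k l (m - 1) =
    G k l m + (a + k%:~R) * (b + l%:~R) / ((c + m%:~R) * (c + m%:~R - 1)) * x
              * G (k + 1) (l + 1) (m + 1);
  contig_c1 (k l m : int) : (1 - x) * G (k + 1) (l + 1) m =
    G k l m + (a + k%:~R + (b + l%:~R) + 1 - (c + m%:~R)) / (c + m%:~R) * x
              * G (k + 1) (l + 1) (m + 1) }.

Section Contiguous.
Variable F : fieldType.
Implicit Types (a b c x : F) (G H : int -> int -> int -> F).

Lemma contiguous_shift a b c x G k l m :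
  contiguous a b c x G ->
  contiguous (a + k%:~R) (b + l%:~R) (c + m%:~R) x
    (fun i j h => G (k + i) (l + j) (m + h)).
Proof.
move=> s; split=> i j h.
- by have := contig_a s (k + i) (l + j) (m + h); rewrite !intrD !addrA.
- by have := contig_a1 s (k + i) (l + j) (m + h); rewrite !intrD !addrA.
- by have := contig_b s (k + i) (l + j) (m + h); rewrite !intrD !addrA.
- by have := contig_b1 s (k + i) (l + j) (m + h); rewrite !intrD !addrA.
- by have := contig_c s (k + i) (l + j) (m + h); rewrite !intrD !addrA.
- by have := contig_c1 s (k + i) (l + j) (m + h); rewrite !intrD !addrA.
Qed.

Lemma contiguous_lin a b c x G1 G2 u v :
  contiguous a b c x G1 -> contiguous a b c x G2 ->
  contiguous a b c x (fun k l m => u * G1 k l m + v * G2 k l m).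
Proof.
move=> s t.
have lin p g1 g2 r1 r2 : p * g1 = r1 -> p * g2 = r2 ->
    p * (u * g1 + v * g2) = u * r1 + v * r2 by move=> <- <-; ring.
split=> k l m.
- by rewrite (contig_a s) (contig_a t); ring.
- by rewrite (lin _ _ _ _ _ (contig_a1 s k l m) (contig_a1 t k l m)); ring.
- by rewrite (contig_b s) (contig_b t); ring.
- by rewrite (lin _ _ _ _ _ (contig_b1 s k l m) (contig_b1 t k l m)); ring.
- by rewrite (contig_c s) (contig_c t); ring.
- by rewrite (lin _ _ _ _ _ (contig_c1 s k l m) (contig_c1 t k l m)); ring.
Qed.

(** Every unit shift has nonzero determinant under these hypotheses, so vanishing of the pair at one
    lattice point spreads to its neighbours in both directions. *)
Lemma contiguous_eq0 a b c x G :
  standing a b c -> x != 0 -> 1 - x != 0 -> contiguous a b c x G ->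
  G 0 0 0 = 0 -> G 1 1 1 = 0 -> forall k l m, G k l m = 0.
Proof.
move=> [ha [hb [hca [hcb [hc _]]]]] x0 x1 s G0 G1.
have nz1 k : a + k%:~R + 1 != 0 by rewrite -addrA -intr_succ notInt_neq0.
have nz2 l : b + l%:~R + 1 != 0 by rewrite -addrA -intr_succ notInt_neq0.
have nz3 m : c + m%:~R != 0 by rewrite notInt_neq0.
have nz3' m : c + m%:~R - 1 != 0 by rewrite -addrA -intr_pred notInt_neq0.
have nz4 k m : a + k%:~R + 1 - (c + m%:~R) != 0.
  have -> : a + k%:~R + 1 - (c + m%:~R) = - (c - a + (m - k - 1)%:~R).
    by rewrite !intrB; ring.
  by rewrite oppr_eq0 notInt_neq0.
have nz5 l m : b + l%:~R + 1 - (c + m%:~R) != 0.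
  have -> : b + l%:~R + 1 - (c + m%:~R) = - (c - b + (m - l - 1)%:~R).
    by rewrite !intrB; ring.
  by rewrite oppr_eq0 notInt_neq0.
suff H k l m : G k l m = 0 /\ G (k + 1) (l + 1) (m + 1) = 0 by move=> k l m; case: (H k l m).
move: k l m; apply: int3_ind_iff => [//|k l m|k l m|k l m].
- have e1 := contig_a s k l m; have e2 := contig_a1 s k l m.
  rewrite -addrA (_ : 1 + 1 = 2) //; split=> -[E0 E1].
    split; first by rewrite e1 E0 E1; ring.
    by apply: (mulfI (mulf_neq0 (nz1 k) x1)); rewrite e2 E0 E1; ring.
  (* Eliminating [G k l m] from [e1] and [e2] leaves [G (k + 1) (l + 1) (m + 1)] times the numerator
     of the determinant of the shift. *)
  have E2 : G (k + 1) (l + 1) (m + 1) = 0.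
    apply: (mulfI (nz4 k m)).
    transitivity ((a + k%:~R + 1) * (1 - x) * G (k + 2) (l + 1) (m + 1) - (c + m%:~R) * G (k + 1) l m).
      by rewrite e2 e1; field.
    by rewrite E0 E1; ring.
  by split=> //; move: e1; rewrite E0 E2 mulr0 addr0.
- have e1 := contig_b s k l m; have e2 := contig_b1 s k l m.
  rewrite -addrA (_ : 1 + 1 = 2) //; split=> -[E0 E1].
    split; first by rewrite e1 E0 E1; ring.
    by apply: (mulfI (mulf_neq0 (nz2 l) x1)); rewrite e2 E0 E1; ring.
  have E2 : G (k + 1) (l + 1) (m + 1) = 0.
    apply: (mulfI (nz5 l m)).
    transitivity ((b + l%:~R + 1) * (1 - x) * G (k + 1) (l + 2) (m + 1) - (c + m%:~R) * G k (l + 1) m).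
      by rewrite e2 e1; field.
    by rewrite E0 E1; ring.
  by split=> //; move: e1; rewrite E0 E2 mulr0 addr0.
- have e1 := contig_c s k l m; have e2 := contig_c1 s k l m.
  rewrite subrK; split=> -[E0 E1].
    split; first by rewrite e1 E0 E1; ring.
    by apply: (mulfI x1); rewrite e2 E0 E1; ring.
  have E2 : G (k + 1) (l + 1) (m + 1) = 0.
    apply: (mulfI (mulf_neq0 x0 (mulf_neq0 (nz4 k m) (nz5 l m)))).
    transitivity ((c + m%:~R) * (c + m%:~R - 1) * (G k l (m - 1) - (1 - x) * G (k + 1) (l + 1) m)).
      by rewrite e2 e1; field; rewrite nz3 nz3'.
    by rewrite E0 E1; ring.
  by split=> //; move: e1; rewrite E0 E2 mulr0 addr0.
Qed.

Lemma contiguous_basis a b c x R Q G :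
  standing a b c -> x != 0 -> 1 - x != 0 ->
  contiguous a b c x R -> contiguous a b c x Q -> contiguous a b c x G ->
  R 0 0 0 = 1 -> R 1 1 1 = 0 -> Q 0 0 0 = 0 -> Q 1 1 1 = 1 ->
  forall k l m, G k l m = Q k l m * G 1 1 1 + R k l m * G 0 0 0.
Proof.
move=> st x0 x1 sR sQ sG R0 R1 Q0 Q1 k l m.
have sD := contiguous_lin 1 (-1) sG (contiguous_lin (G 1 1 1) (G 0 0 0) sQ sR).
apply/eqP; rewrite -subr_eq0; apply/eqP.
rewrite -[RHS](contiguous_eq0 st x0 x1 sD _ _ k l m); first by ring.
  by rewrite R0 Q0; ring.
by rewrite R1 Q1; ring.
Qed.

Lemma contiguous_swap a b c x H :
  contiguous b a c x H -> contiguous a b c x (fun k l m => H l k m).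
Proof.
move=> s; split=> k l m.
- exact: (contig_b s l k m).
- exact: (contig_b1 s l k m).
- exact: (contig_a s l k m).
- exact: (contig_a1 s l k m).
- by rewrite (contig_c s) [_ * (b + _)]mulrC.
- by rewrite (contig_c1 s) [a + _ + (b + _)]addrC.
Qed.

(** Take [(m - k, l, m)] as base point for [H]; its first parameter is [c + m - (a + k) - 1]. All
    values of [H] that occur, including those in [G0] and [G1], are combinations of the base pair
    [p], [q], and each relation becomes an identity of rational functions. *)
Lemma contiguous_pfaff a b c x H :
  standing a b c -> 1 - x != 0 ->
  contiguous (c - a - 1) b c (x / (x - 1)) H ->
  contiguous a b c x (fun k l m => (1 - x) ^ (- l) * H (m + 1 - k) l m).
Proof.
move=> [ha [hb [hca [hcb [hc _]]]]] x1 s.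
suff K k l m : let A := a + k%:~R in let B := b + l%:~R in let C := c + m%:~R in
  let G k l m := (1 - x) ^ (- l) * H (m + 1 - k) l m in
  let G0 := G k l m in let G1 := G (k + 1) (l + 1) (m + 1) in
  ([/\ G (k + 1) l m = G0 + B / C * x * G1,
       (A + 1) * (1 - x) * G (k + 2) (l + 1) (m + 1) = C * G0 + (A + 1 - C + B * x) * G1 &
       G k (l + 1) m = G0 + A / C * x * G1] /\
   [/\ (B + 1) * (1 - x) * G (k + 1) (l + 2) (m + 1) = C * G0 + (B + 1 - C + A * x) * G1,
       G k l (m - 1) = G0 + A * B / (C * (C - 1)) * x * G1 &
       (1 - x) * G (k + 1) (l + 1) m = G0 + (A + B + 1 - C) / C * x * G1]).
  by split=> k l m; case: (K k l m) => -[? ? ?] [? ? ?].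
have x1' : x - 1 != 0 by rewrite -oppr_eq0 opprB.
have B1 : b + l%:~R + 1 != 0 by rewrite -addrA -intr_succ notInt_neq0.
have C0 : c + m%:~R != 0 by rewrite notInt_neq0.
have C1 : c + m%:~R + 1 != 0 by rewrite -addrA -intr_succ notInt_neq0.
have Cm : c + m%:~R - 1 != 0 by rewrite -addrA -intr_pred notInt_neq0.
have A1 : a + k%:~R + 1 != 0 by rewrite -addrA -intr_succ notInt_neq0.
rewrite /= (_ : m + 1 - k = m - k + 1); last by ring.
rewrite (_ : m + 1 - (k + 1) = m - k); last by ring.
rewrite (_ : m + 1 + 1 - (k + 1) = m - k + 1); last by ring.
rewrite (_ : m + 1 + 1 - (k + 2) = m - k); last by ring.
rewrite (_ : m - 1 + 1 - k = m - k); last by ring.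
rewrite !(opprD l) !expfzDr // (_ : (1 - x) ^ (- 2 : int) = (1 - x)^-1 * (1 - x)^-1); last first.
  by rewrite -invfM.
rewrite (_ : (1 - x) ^ (- 1 : int) = (1 - x)^-1) //.
move: ((1 - x) ^ (- l)) => g.
have ea : c - a - 1 + (m - k)%:~R = (c + m%:~R) - (a + k%:~R) - 1 by rewrite intrB; ring.
have := contig_a s (m - k) l m; have := contig_c s (m - k) l m.
have := contig_c1 s (m - k) l m; have := contig_b s (m - k) l m.
have := contig_b1 s (m - k) l m.
have := contig_a s (m - k) (l + 1) (m + 1); have := contig_c s (m - k) (l + 1) (m + 1).
rewrite ea addrK !intr_succ !(addrA b) !(addrA c) -!(addrA l 1 1) -!(addrA m 1 1).
rewrite (_ : 1 + 1 = 2) //.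
move: (H (m - k) l m) (H (m - k + 1) (l + 1) (m + 1)) => p q.
move: (H (m - k) (l + 1) (m + 1)) (H (m - k + 1) (l + 2) (m + 2)) => h011 h122.
move: (H (m - k) (l + 1) m) (H (m - k) l (m - 1)) (H (m - k + 1) (l + 1) m)
  (H (m - k + 1) (l + 2) (m + 1)) (H (m - k + 1) l m) => h010 h00m h110 h121 h100.
move: (a + k%:~R) (b + l%:~R) (c + m%:~R) B1 C0 C1 Cm A1 {ea}
  => A B C B1 C0 C1 Cm A1 E1 E2 E3 E4 E5 -> ->.
(* The relations at the base point do not give [h011]; it is reached by eliminating [h122] from two
   relations at [(m - k, l + 1, m + 1)]. *)
have E6 : (A + 1) * h011 = C * h010 - (C - A - 1) * q.
  by rewrite E1 E2; field; rewrite addrK C1 C0 x1'.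
have {}E6 : h011 = (C * h010 - (C - A - 1) * q) / (A + 1).
  by rewrite -E6 mulrC mulKf.
rewrite {}E6 {}E4.
have y1 : 1 - x / (x - 1) != 0.
  by rewrite (_ : 1 - x / (x - 1) = (1 - x)^-1) ?invr_eq0 //; field; rewrite x1 x1'.
have {E3} -> := canRL (mulKf (mulf_neq0 B1 y1)) E3.
have {E5} -> := canRL (mulKf y1) E5.
have y1' : x - 1 - x != 0 by rewrite addrAC subrr sub0r oppr_eq0 oner_neq0.
split; split; field; rewrite ?x1 ?x1' ?C0 ?C1 ?A1 ?B1 ?Cm ?y1' //. 
Qed.

(* Ratio of the values at [(a+k, b+l, c+m)] and at [(a, b, c)] of the
   connection coefficient [Gamma(c) Gamma(c-a-b) / (Gamma(c-a) Gamma(c-b))]. *)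
Definition connection_factor a b c (k l m : int) : F :=
  poch c m * poch (c - a - b) (m - k - l) / (poch (c - a) (m - k) * poch (c - b) (m - l)).

(** Raising [m] lowers the third index of [H], so the base point is [(k, l, k + l - m + 1)]: from
    there [contig_c] and [contig_c1] give the values of [H] in [G0] and [G1]. *)
Lemma contiguous_connection a b c x H :
  standing a b c -> x != 0 -> 1 - x != 0 ->
  contiguous a b (a + b + 1 - c) (1 - x) H ->
  contiguous a b c x (fun k l m => connection_factor a b c k l m * H k l (k + l - m)).
Proof.
move=> [ha [hb [hca [hcb [hc [hcab _]]]]]] x0 x1 s.
suff K k l m : let A := a + k%:~R in let B := b + l%:~R in let C := c + m%:~R in
  let G k l m := connection_factor a b c k l m * H k l (k + l - m) in
  let G0 := G k l m in let G1 := G (k + 1) (l + 1) (m + 1) in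
  ([/\ G (k + 1) l m = G0 + B / C * x * G1,
       (A + 1) * (1 - x) * G (k + 2) (l + 1) (m + 1) = C * G0 + (A + 1 - C + B * x) * G1 &
       G k (l + 1) m = G0 + A / C * x * G1] /\
   [/\ (B + 1) * (1 - x) * G (k + 1) (l + 2) (m + 1) = C * G0 + (B + 1 - C + A * x) * G1,
       G k l (m - 1) = G0 + A * B / (C * (C - 1)) * x * G1 &
       (1 - x) * G (k + 1) (l + 1) m = G0 + (A + B + 1 - C) / C * x * G1]).
  by split=> k l m; case: (K k l m) => -[? ? ?] [? ? ?].
have A1 : a + k%:~R + 1 != 0 by rewrite -addrA -intr_succ notInt_neq0.
have B1 : b + l%:~R + 1 != 0 by rewrite -addrA -intr_succ notInt_neq0.
have C0 : c + m%:~R != 0 by rewrite notInt_neq0.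
have Cm : c + m%:~R - 1 != 0 by rewrite -addrA -intr_pred notInt_neq0.
have nzCA i : c + m%:~R - (a + k%:~R) - i%:~R != 0.
  have -> : c + m%:~R - (a + k%:~R) - i%:~R = c - a + (m - k - i)%:~R by rewrite !intrB; ring.
  exact: notInt_neq0.
have nzCB i : c + m%:~R - (b + l%:~R) - i%:~R != 0.
  have -> : c + m%:~R - (b + l%:~R) - i%:~R = c - b + (m - l - i)%:~R by rewrite !intrB; ring.
  exact: notInt_neq0.
have nzCAB i : c + m%:~R - (a + k%:~R) - (b + l%:~R) - i%:~R != 0.
  have -> : c + m%:~R - (a + k%:~R) - (b + l%:~R) - i%:~R = c - a - b + (m - k - l - i)%:~R.
    by rewrite !intrB; ring.
  exact: notInt_neq0.
have pca := poch_neq0 (m - k) hca; have pcb := poch_neq0 (m - l) hcb.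
rewrite /= /connection_factor.
rewrite (_ : k + 1 + l - m = k + l - m + 1); last by ring.
rewrite (_ : k + (l + 1) - m = k + l - m + 1); last by ring.
rewrite (_ : k + 1 + (l + 1) - (m + 1) = k + l - m + 1); last by ring.
rewrite (_ : k + 2 + (l + 1) - (m + 1) = k + l - m + 2); last by ring.
rewrite (_ : k + 1 + (l + 2) - (m + 1) = k + l - m + 2); last by ring.
rewrite (_ : k + l - (m - 1) = k + l - m + 1); last by ring.
rewrite (_ : k + 1 + (l + 1) - m = k + l - m + 2); last by ring.
rewrite (_ : m - (k + 1) - l = m - k - l - 1); last by ring.
rewrite (_ : m - k - (l + 1) = m - k - l - 1); last by ring.
rewrite (_ : m + 1 - (k + 1) - (l + 1) = m - k - l - 1); last by ring.
rewrite (_ : m + 1 - (k + 2) - (l + 1) = m - k - l - 1 - 1); last by ring.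
rewrite (_ : m + 1 - (k + 1) - (l + 2) = m - k - l - 1 - 1); last by ring.
rewrite (_ : m - 1 - k - l = m - k - l - 1); last by ring.
rewrite (_ : m - (k + 1) - (l + 1) = m - k - l - 1 - 1); last by ring.
rewrite (_ : m + 1 - (k + 1) = m - k); last by ring.
rewrite (_ : m + 1 - (l + 1) = m - l); last by ring.
rewrite (_ : m - (k + 1) = m - k - 1); last by ring.
rewrite (_ : m - (l + 1) = m - l - 1); last by ring.
rewrite (_ : m + 1 - (k + 2) = m - k - 1); last by ring.
rewrite (_ : m + 1 - (l + 2) = m - l - 1); last by ring.
rewrite (_ : m - 1 - k = m - k - 1); last by ring.
rewrite (_ : m - 1 - l = m - l - 1); last by ring.
(* The indices are now unit shifts of [m], [m - k], [m - l] and [m - k - l], so every Pochhammer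
   symbol reduces to one of four, up to a rational factor. *)
rewrite !poch_pred // !poch_succ //.
have -> : c - a + (m - k)%:~R = c + m%:~R - (a + k%:~R) by rewrite intrB; ring.
have -> : c - b + (m - l)%:~R = c + m%:~R - (b + l%:~R) by rewrite intrB; ring.
rewrite intr_pred.
have -> : (c - a - b + ((m - k - l)%:~R - 1) - 1) = c + m%:~R - (a + k%:~R) - (b + l%:~R) - 2%:~R.
  by rewrite !intrB; ring.
have -> : c - a - b + (m - k - l)%:~R = c + m%:~R - (a + k%:~R) - (b + l%:~R) by rewrite !intrB; ring.
have ec : a + b + 1 - c + (k + l - m)%:~R = (a + k%:~R) + (b + l%:~R) + 1 - (c + m%:~R).
  by rewrite intrB intrD; ring.
have := contig_a s k l (k + l - m + 1); have := contig_b s k l (k + l - m + 1).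
have := contig_a1 s k l (k + l - m + 1); have := contig_b1 s k l (k + l - m + 1).
have := contig_c1 s k l (k + l - m + 1); have := contig_c s k l (k + l - m + 1).
rewrite addrK intr_succ addrA ec -!(addrA (k + l - m) 1 1) (_ : 1 + 1 = 2) // (_ : 2%:~R = 2) //.
move: (H k l (k + l - m)) (H (k + 1) (l + 1) (k + l - m + 1)) => h0 h1.
move: (H k l (k + l - m + 1)) (H (k + 1) (l + 1) (k + l - m + 2)) => p q.
move: (H (k + 1) l _) (H k (l + 1) _) (H (k + 2) _ _) (H _ (l + 2) _) => h101 h011 h212 h122.
have := nzCA 1; have := nzCB 1; have := nzCAB 1; have := nzCAB 2; have := nzCAB 0.
have := nzCA 0; have := nzCB 0; rewrite !subr0.
move: (poch c m) (poch _ _) (poch _ _) (poch _ _) pca pcb => g1 g2 g3 g4 pca pcb.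
move: (a + k%:~R) (b + l%:~R) (c + m%:~R) A1 B1 C0 Cm {ec nzCA nzCB nzCAB}.
move=> A B C A1 B1 C0 Cm CB0 CA0 CAB0 CAB2 CAB1 CB1 CA1.
have nz1 : A + B + 1 - C != 0.
  by rewrite (_ : _ - C = - (C - A - B - 1%:~R)) ?oppr_eq0 //; ring.
have nz2 : A + B + 1 - C + 1 != 0.
  by rewrite (_ : _ + 1 = - (C - A - B - 2%:~R)) ?oppr_eq0 //; ring.
rewrite !addrK (_ : 1 - (1 - x) = x); last by ring.
move=> -> E1 E2 E3 -> ->.
have {E1} -> := canRL (mulKf x0) E1.
have {E2} -> := canRL (mulKf (mulf_neq0 B1 x0)) E2.
have {E3} -> := canRL (mulKf (mulf_neq0 A1 x0)) E3.
rewrite (_ : 1%:~R = 1) // (_ : 2%:~R = 2) // in CAB2 CAB1 CB1 CA1 *.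
by split; split; field;
  rewrite ?x0 ?A1 ?B1 ?C0 ?Cm ?CAB1 ?CAB2 ?CA1 ?CB1 ?nz1 ?nz2 ?pca ?pcb.
Qed.

(** Product of the determinants of the unit shifts leading from [(0, 0, 0)] to [(k, l, m)]. *)
Definition wronskian_factor a b c x (k l m : int) : F :=
  poch (c + 1) m * poch c m
  / (poch (a + 1) k * poch (b + 1) l * poch (c - a) (m - k) * poch (c - b) (m - l))
  * (-1) ^ (m - k - l) * x ^ (- m) * (1 - x) ^ (m - k - l).

Lemma contiguous_wronskian a b c x R Q :
  standing a b c -> x != 0 -> 1 - x != 0 ->
  contiguous a b c x R -> contiguous a b c x Q ->
  R 0 0 0 = 1 -> R 1 1 1 = 0 -> Q 0 0 0 = 0 -> Q 1 1 1 = 1 ->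
  forall k l m, R k l m * Q (k + 1) (l + 1) (m + 1) - Q k l m * R (k + 1) (l + 1) (m + 1)
                = wronskian_factor a b c x k l m.
Proof.
move=> [ha [hb [hca [hcb [hc _]]]]] x0 x1 sR sQ R0 R1 Q0 Q1.
have ha1 : notInt (a + 1) := notIntD 1 ha.
have hb1 : notInt (b + 1) := notIntD 1 hb.
have hc1 : notInt (c + 1) := notIntD 1 hc.
have nz1 k : a + k%:~R + 1 != 0 by rewrite -addrA -intr_succ notInt_neq0.
have nz2 l : b + l%:~R + 1 != 0 by rewrite -addrA -intr_succ notInt_neq0.
have nz3 m : c + m%:~R != 0 by rewrite notInt_neq0.
have nz3' m : c + m%:~R - 1 != 0 by rewrite -addrA -intr_pred notInt_neq0.
have nz4 k m : c + m%:~R - (a + k%:~R) - 1 != 0.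
  have -> : c + m%:~R - (a + k%:~R) - 1 = c - a + (m - k - 1)%:~R by rewrite !intrB; ring.
  exact: notInt_neq0.
have nz5 l m : c + m%:~R - (b + l%:~R) - 1 != 0.
  have -> : c + m%:~R - (b + l%:~R) - 1 = c - b + (m - l - 1)%:~R by rewrite !intrB; ring.
  exact: notInt_neq0.
have ea k : a + 1 + k%:~R = a + k%:~R + 1 by ring.
have eb k : b + 1 + k%:~R = b + k%:~R + 1 by ring.
have ec1 k : c + 1 + k%:~R - 1 = c + k%:~R by ring.
have eca k m : c - a + (m - k)%:~R = c + m%:~R - (a + k%:~R) by rewrite intrB; ring.
have ecb k m : c - b + (m - k)%:~R = c + m%:~R - (b + k%:~R) by rewrite intrB; ring.
have step (u D D' d d' : F) : u != 0 -> D' = u * D -> d' = u * d -> (D = d <-> D' = d').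
  by move=> u0 -> ->; split=> [-> //|/(mulfI u0)].
have m1 : -1 != 0 :> F by rewrite oppr_eq0 oner_neq0.
apply: int3_ind_iff => [|k l m|k l m|k l m].
- rewrite /wronskian_factor !subr0 oppr0 !poch0 !expr0z !mulr1 invr1 !add0r.
  by rewrite R0 R1 Q0 Q1; ring.
(* The multiplier is the determinant of the matrix given by [contig_a] and [contig_a1]; the steps in
   [b] and [c] use theirs in the same way. *)
- apply: (step (- (c + m%:~R - (a + k%:~R) - 1) / ((a + k%:~R + 1) * (1 - x)))).
  + by rewrite mulf_neq0 ?oppr_eq0 ?invr_eq0 ?mulf_neq0.
  + rewrite -(addrA k 1 1) (_ : 1 + 1 = 2) // (contig_a sR) (contig_a sQ).
    have -> := canRL (mulKf (mulf_neq0 (nz1 k) x1)) (contig_a1 sR k l m).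
    have -> := canRL (mulKf (mulf_neq0 (nz1 k) x1)) (contig_a1 sQ k l m).
    by field; rewrite ?x1 ?nz1 ?nz3.
  + rewrite /wronskian_factor (_ : m - (k + 1) = m - k - 1); last by ring.
    rewrite (_ : m - k - 1 - l = m - k - l - 1); last by ring.
    rewrite !expfzDr // poch_succ // poch_pred // ea eca.
    rewrite (_ : (-1) ^ (- 1 : int) = -1 :> F); last by rewrite -exprz_inv invrN1.
    rewrite (_ : (1 - x) ^ (- 1 : int) = (1 - x)^-1) //.
    by field; rewrite ?x1 ?nz1 ?nz4 ?poch_neq0.
- apply: (step (- (c + m%:~R - (b + l%:~R) - 1) / ((b + l%:~R + 1) * (1 - x)))).
  + by rewrite mulf_neq0 ?oppr_eq0 ?invr_eq0 ?mulf_neq0.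
  + rewrite -(addrA l 1 1) (_ : 1 + 1 = 2) // (contig_b sR) (contig_b sQ).
    have -> := canRL (mulKf (mulf_neq0 (nz2 l) x1)) (contig_b1 sR k l m).
    have -> := canRL (mulKf (mulf_neq0 (nz2 l) x1)) (contig_b1 sQ k l m).
    by field; rewrite ?x1 ?nz2 ?nz3.
  + rewrite /wronskian_factor (_ : m - (l + 1) = m - l - 1); last by ring.
    rewrite (_ : m - k - (l + 1) = m - k - l - 1); last by ring.
    rewrite !expfzDr // poch_succ // poch_pred // eb ecb.
    rewrite (_ : (-1) ^ (- 1 : int) = -1 :> F); last by rewrite -exprz_inv invrN1.
    rewrite (_ : (1 - x) ^ (- 1 : int) = (1 - x)^-1) //.
    by field; rewrite ?x1 ?nz2 ?nz5 ?poch_neq0.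
- apply: (step (- x * (c + m%:~R - (a + k%:~R) - 1) * (c + m%:~R - (b + l%:~R) - 1)
      / ((1 - x) * (c + m%:~R) * (c + m%:~R - 1)))).
  + by rewrite !mulf_neq0 ?oppr_eq0 ?invr_eq0 ?mulf_neq0.
  + rewrite subrK (contig_c sR) (contig_c sQ).
    have -> := canRL (mulKf x1) (contig_c1 sR k l m).
    have -> := canRL (mulKf x1) (contig_c1 sQ k l m).
    by field; rewrite ?x1 ?nz3 ?nz3'.
  + rewrite /wronskian_factor (_ : m - 1 - k = m - k - 1); last by ring.
    rewrite (_ : m - k - 1 - l = m - k - l - 1); last by ring.
    rewrite (_ : m - 1 - l = m - l - 1) ?opprB; last by ring.
    rewrite (addrC 1) !expfzDr // !poch_pred // eca ecb ec1.
    rewrite (_ : (-1) ^ (- 1 : int) = -1 :> F); last by rewrite -exprz_inv invrN1.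
    rewrite (_ : (1 - x) ^ (- 1 : int) = (1 - x)^-1) // expr1z.
    by field; rewrite ?x1 ?nz3 ?nz3' ?nz4 ?nz5 ?poch_neq0.
Qed.

Lemma contiguous_uniq a b c x R G :
  standing a b c -> x != 0 -> 1 - x != 0 ->
  contiguous a b c x R -> contiguous a b c x G ->
  R 0 0 0 = G 0 0 0 -> R 1 1 1 = G 1 1 1 -> forall k l m, R k l m = G k l m.
Proof.
move=> st x0 x1 sR sG e0 e1 k l m.
have sD := contiguous_lin 1 (-1) sR sG.
apply/eqP; rewrite -subr_eq0; apply/eqP.
rewrite -[RHS](contiguous_eq0 st x0 x1 sD _ _ k l m) ?e0 ?e1; ring.
Qed.

(* Cramer's rule: [R k l m] is, up to sign and the Wronskian, the coefficient of
   [F(a+k-1, b+l-1, c+m-1)] when [F(a+1, b+1, c+1)] is expanded over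
   [F(a+k, b+l, c+m)] and [F(a+k-1, b+l-1, c+m-1)]. *)
Lemma contiguous_reversal a b c x R Q (k l m : int) R' Q' :
  standing a b c -> x != 0 -> 1 - x != 0 ->
  contiguous a b c x R -> contiguous a b c x Q ->
  R 0 0 0 = 1 -> R 1 1 1 = 0 -> Q 0 0 0 = 0 -> Q 1 1 1 = 1 ->
  standing (a + (k - 1)%:~R) (b + (l - 1)%:~R) (c + (m - 1)%:~R) ->
  contiguous (a + (k - 1)%:~R) (b + (l - 1)%:~R) (c + (m - 1)%:~R) x R' ->
  contiguous (a + (k - 1)%:~R) (b + (l - 1)%:~R) (c + (m - 1)%:~R) x Q' ->
  R' 0 0 0 = 1 -> R' 1 1 1 = 0 -> Q' 0 0 0 = 0 -> Q' 1 1 1 = 1 ->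
  R k l m = - wronskian_factor a b c x (k - 1) (l - 1) (m - 1)
            * R' (2 - k) (2 - l) (2 - m).
Proof.
move=> st x0 x1 sR sQ R0 R1 Q0 Q1 st' sR' sQ' R0' R1' Q0' Q1'.
(* Seen from the base point [(k - 1, l - 1, m - 1)], the point [(1, 1, 1)] has offset
   [(2 - k, 2 - l, 2 - m)]: this is the origin of the indices in [sig0]. *)
have E G (sG : contiguous a b c x G) : G 1 1 1 =
    Q' (2 - k) (2 - l) (2 - m) * G k l m + R' (2 - k) (2 - l) (2 - m) * G (k - 1) (l - 1) (m - 1).
  have := contiguous_basis st' x0 x1 sR' sQ' (contiguous_shift (k - 1) (l - 1) (m - 1) sG)
    R0' R1' Q0' Q1' (2 - k) (2 - l) (2 - m).
  rewrite !addr0 !subrK.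
  have e i : i - 1 + (2 - i) = 1 :> int by ring.
  by rewrite !e.
have := contiguous_wronskian st x0 x1 sR sQ R0 R1 Q0 Q1 (k - 1) (l - 1) (m - 1).
rewrite !subrK => <-.
have := E _ sR; have := E _ sQ; rewrite R1 Q1 => eQ eR.
(* The [1] and [0] stand for [Q 1 1 1] and [R 1 1 1]. After expansion by [E] the terms in [Q']
   cancel, and [R'] is left times minus the Wronskian. *)
transitivity (R k l m * 1 - Q k l m * 0); first by ring.
by rewrite eQ eR; ring.
Qed.

(** Every coefficient is spelled out as [u + v * x], so that all six relations are instances of one
    pattern, the image of the polynomials [linp u v]. *)
Lemma contiguous_linear a b c x G :
  (forall k l m : int, let A := a + k%:~R in let B := b + l%:~R in let C := c + m%:~R in
   let G0 := G k l m in let G1 := G (k + 1) (l + 1) (m + 1) in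
   ([/\ (1 + 0 * x) * G (k + 1) l m = (1 + 0 * x) * G0 + (0 + B / C * x) * G1,
       (A + 1 + - (A + 1) * x) * G (k + 2) (l + 1) (m + 1)
         = (C + 0 * x) * G0 + (A + 1 - C + B * x) * G1 &
       (1 + 0 * x) * G k (l + 1) m = (1 + 0 * x) * G0 + (0 + A / C * x) * G1] /\
   [/\ (B + 1 + - (B + 1) * x) * G (k + 1) (l + 2) (m + 1)
         = (C + 0 * x) * G0 + (B + 1 - C + A * x) * G1,
       (1 + 0 * x) * G k l (m - 1)
         = (1 + 0 * x) * G0 + (0 + A * B / (C * (C - 1)) * x) * G1 &
       (1 + (-1) * x) * G (k + 1) (l + 1) m
         = (1 + 0 * x) * G0 + (0 + (A + B + 1 - C) / C * x) * G1])) ->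
  contiguous a b c x G.
Proof.
move=> K; split=> k l m; case: (K k l m) => -[e1 e2 e3] [e4 e5 e6].
- by move: e1; rewrite mul0r addr0 !mul1r add0r.
- by rewrite [_ * (1 - x)](_ : _ = (a + k%:~R + 1 + - (a + k%:~R + 1) * x)) ?e2; ring.
- by move: e3; rewrite mul0r addr0 !mul1r add0r.
- by rewrite [_ * (1 - x)](_ : _ = (b + l%:~R + 1 + - (b + l%:~R + 1) * x)) ?e4; ring.
- by move: e5; rewrite mul0r addr0 !mul1r add0r.
- by rewrite [1 - x](_ : _ = (1 + (-1) * x)) ?e6; ring.
Qed.
End Contiguous.

Lemma contiguous_rmorph (F F' : fieldType) (phi : {rmorphism F -> F'}) a b c x G :
  contiguous a b c x G ->
  contiguous (phi a) (phi b) (phi c) (phi x) (fun k l m => phi (G k l m)).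
Proof.
pose mE := (rmorphD phi, rmorphM phi, rmorphN phi, rmorph1 phi, fmorphV phi, rmorph_int phi).
move=> s; split=> k l m.
- by have /(congr1 phi) := contig_a s k l m; rewrite !mE.
- by have /(congr1 phi) := contig_a1 s k l m; rewrite !mE.
- by have /(congr1 phi) := contig_b s k l m; rewrite !mE.
- by have /(congr1 phi) := contig_b1 s k l m; rewrite !mE.
- by have /(congr1 phi) := contig_c s k l m; rewrite !mE.
- by have /(congr1 phi) := contig_c1 s k l m; rewrite !mE.
Qed.

(** * Power series relations between contiguous functions *)

Lemma div_comb (F : fieldType) (p d1 d2 p1 q1 p2 q2 : F) :
  p != 0 -> d1 != 0 -> d2 != 0 ->
  (p1 * (q1 / d1) + p2 * (q2 / d2)) / p = (p1 * d2 * q1 + p2 * d1 * q2) / (d1 * d2 * p).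
Proof. by move=> p0 d10 d20; field; rewrite p0 d10 d20. Qed.

Section Series.
Variable K : fieldType.
Implicit Types (p q r d : {poly K}) (f g h : nat -> K).

(** Coefficient [n] of the product sees only finitely many terms of the series; truncating it to a
    polynomial makes the ring laws of [{poly K}] available. *)
Lemma pmulS_poly N p f n : (n < N)%N -> pmulS p f n = (p * \poly_(i < N) f i)`_n.
Proof.
move=> nN; rewrite coefM; apply: eq_bigr => i _.
by rewrite coef_poly (leq_ltn_trans (leq_subr _ _) nN).
Qed.

Lemma pmulS_mulp p q f n : pmulS (p * q) f n = pmulS p (pmulS q f) n.
Proof.
rewrite (pmulS_poly _ _ (ltnSn n)) -mulrA coefM; apply: eq_bigr => i _.
by rewrite -pmulS_poly // ltnS leq_subr.
Qed.

Lemma pmulS_addp p q f n : pmulS (p + q) f n = pmulS p f n + pmulS q f n.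
Proof. by rewrite -big_split; apply: eq_bigr => i _; rewrite coefD mulrDl. Qed.

Lemma pmulS_oppp p f n : pmulS (- p) f n = - pmulS p f n.
Proof. by rewrite -sumrN; apply: eq_bigr => i _; rewrite coefN mulNr. Qed.

Lemma pmulS_adds p f g n :
  pmulS p (fun i => f i + g i) n = pmulS p f n + pmulS p g n.
Proof. by rewrite -big_split; apply: eq_bigr => i _; rewrite mulrDr. Qed.

Lemma eq_pmulS p f g : f =1 g -> pmulS p f =1 pmulS p g.
Proof. by move=> fg n; apply: eq_bigr => i _; rewrite fg. Qed.

Lemma pmulSC p q f n : pmulS p (pmulS q f) n = pmulS q (pmulS p f) n.
Proof. by rewrite -!pmulS_mulp mulrC. Qed.

Lemma pmulSX f n : pmulS 'X f n = if n is n'.+1 then f n' else 0.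
Proof.
rewrite (pmulS_poly _ _ (ltnSn n)) coefXM; case: n => //= n.
by rewrite coef_poly ltnW.
Qed.

Definition linp (u v : K) : {poly K} := u%:P + v *: 'X.

Lemma linp_neq0 u v : u != 0 -> linp u v != 0.
Proof.
move=> u0; apply/eqP => /(congr1 (fun p : {poly K} => p`_0)).
by rewrite coefD coefC coefZ coefX mulr0 addr0 coef0; apply/eqP.
Qed.

Lemma linp_neq0r u v : v != 0 -> linp u v != 0.
Proof.
move=> v0; apply/eqP => /(congr1 (fun p : {poly K} => p`_1)).
by rewrite coefD coefC coefZ coefX mulr1 add0r coef0; apply/eqP.
Qed.

Lemma pmulS_lin u v f n :
  pmulS (linp u v) f n = u * f n + v * (if n is n'.+1 then f n' else 0).
Proof.
rewrite pmulS_addp -mul_polyC pmulS_mulp pmulSC pmulSX.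
have cst w g i : pmulS w%:P g i = w * g i.
  by rewrite (pmulS_poly _ _ (ltnSn i)) coefCM coef_poly ltnSn.
by rewrite cst; case: n => [|n]; rewrite ?mulr0 ?cst.
Qed.

Local Notation tofrac := (@FracField.tofrac {poly K}).

(** Abstracts [contig_rel] from the hypergeometric series; [contig_rel] is an instance by
    conversion, so the lemmas below apply to it directly. *)
Definition span_rel f0 f1 h (Q R : ratfun K) : Prop :=
  exists q r d : {poly K},
    [/\ d != 0, Q = tofrac q / tofrac d, R = tofrac r / tofrac d &
        forall n, pmulS d h n = pmulS q f1 n + pmulS r f0 n].

(** Serves twice: it propagates existence of the coefficients along a relation between series and,
    combined with uniqueness, turns that relation into one between the coefficients. *)
Lemma span_rel_comb f0 f1 h h1 h2 p p1 p2 Q1 R1 Q2 R2 :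
  p != 0 -> (forall n, pmulS p h n = pmulS p1 h1 n + pmulS p2 h2 n) ->
  span_rel f0 f1 h1 Q1 R1 -> span_rel f0 f1 h2 Q2 R2 ->
  span_rel f0 f1 h ((tofrac p1 * Q1 + tofrac p2 * Q2) / tofrac p)
                   ((tofrac p1 * R1 + tofrac p2 * R2) / tofrac p).
Proof.
move=> p0 E [q1 [r1 [d1 [d1nz -> -> E1]]]] [q2 [r2 [d2 [d2nz -> -> E2]]]].
exists (p1 * d2 * q1 + p2 * d1 * q2), (p1 * d2 * r1 + p2 * d1 * r2), (d1 * d2 * p).
have [fp fd1 fd2] : [/\ tofrac p != 0, tofrac d1 != 0 & tofrac d2 != 0].
  by rewrite !tofrac_eq0.
split.
- by rewrite !mulf_neq0.
- by rewrite (div_comb _ _ _ _ fp fd1 fd2) tofracD !tofracM.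
- by rewrite (div_comb _ _ _ _ fp fd1 fd2) tofracD !tofracM.
move=> n; rewrite pmulS_mulp (eq_pmulS _ E) pmulS_adds -!pmulS_mulp.
rewrite (_ : d1 * d2 * p1 = p1 * d2 * d1); last by ring.
rewrite (_ : d1 * d2 * p2 = p2 * d1 * d2); last by ring.
rewrite (pmulS_mulp (p1 * d2)) (eq_pmulS _ E1) (pmulS_mulp (p2 * d1)) (eq_pmulS _ E2).
by rewrite !pmulS_adds !pmulS_addp -!pmulS_mulp; ring.
Qed.

Definition series_free f0 f1 := forall q r,
  (forall n, pmulS q f1 n + pmulS r f0 n = 0) -> q = 0 /\ r = 0.

Lemma span_rel_uniq f0 f1 h Q R Q' R' : series_free f0 f1 ->
  span_rel f0 f1 h Q R -> span_rel f0 f1 h Q' R' -> Q' = Q /\ R' = R.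
Proof.
move=> fr [q [r [d [d0 -> -> E]]]] [q' [r' [d' [d'0 -> -> E']]]].
have [] := fr (d' * q - d * q') (d' * r - d * r').
  move=> n; rewrite !(pmulS_addp, pmulS_oppp) !pmulS_mulp.
  rewrite addrACA -opprD -!pmulS_adds -(eq_pmulS _ E) -(eq_pmulS _ E').
  by rewrite pmulSC subrr.
have [fd fd'] : tofrac d != 0 /\ tofrac d' != 0 by rewrite !tofrac_eq0.
move=> /eqP; rewrite subr_eq0 => /eqP eq /eqP; rewrite subr_eq0 => /eqP er.
split; apply/eqP; rewrite (eqr_div _ _ fd' fd) -!tofracM mulrC.
  by rewrite -eq mulrC.
by rewrite -er mulrC.
Qed.

Lemma span_rel_base0 f0 f1 : span_rel f0 f1 f0 0 1.
Proof.
exists 0, 1, 1; split; rewrite ?oner_neq0 ?tofrac0 ?tofrac1 ?mul0r ?divr1 // => n.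
(* The zero polynomial is written as [1 - 1] so that its product with the series cancels. *)
by rewrite -[in RHS](addrN 1) pmulS_addp pmulS_oppp subrr add0r.
Qed.

Lemma span_rel_base1 f0 f1 : span_rel f0 f1 f1 1 0.
Proof.
exists 1, 0, 1; split; rewrite ?oner_neq0 ?tofrac0 ?tofrac1 ?mul0r ?divr1 // => n.
by rewrite -[X in _ + pmulS X _ _](addrN 1) pmulS_addp pmulS_oppp subrr addr0.
Qed.

End Series.

(** * Contiguity relations and linear independence of hypergeometric series *)

Section Hypergeometric.
Variable K : fieldType.
Hypothesis char0 : has_pchar0 K.
Implicit Types (a b c : K).

Lemma natrS_neq0 (n : nat) : n.+1%:R != 0 :> K.
Proof. by rewrite ((pcharf0P K).1 char0). Qed.

Lemma notInt_neq0n a (n : nat) : notInt a -> a + n%:R != 0.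
Proof. exact: (@notInt_neq0 _ a n). Qed.

Lemma poch_succl a (n : nat) : a * poch (a + 1) n = poch a n * (a + n%:R).
Proof.
transitivity (\prod_(i < n.+1) (a + i%:R)); last by rewrite big_ord_recr.
rewrite big_ord_recl /= addr0.
by congr (_ * _); apply: eq_bigr => i _; rewrite -addrA -natr1 [1 + _]addrC.
Qed.

Lemma hypF0 a b c : hypF a b c 0 = 1.
Proof. by rewrite /hypF /= !big_ord0 !mulr1 divr1. Qed.

Lemma hypF_sym a b c n : hypF a b c n = hypF b a c n.
Proof. by rewrite /hypF [poch a n * _]mulrC. Qed.

Lemma hypFS a b c n : hypF a b c n.+1 =
  hypF a b c n * ((a + n%:R) * (b + n%:R) / ((c + n%:R) * n.+1%:R)).
Proof.
rewrite /hypF /= !big_ord_recr /= factS natrM !invfM; ring.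
Qed.

Lemma hypF_a a b c n : a != 0 -> hypF (a + 1) b c n = hypF a b c n * ((a + n%:R) / a).
Proof.
move=> a0; rewrite /hypF; have := canRL (mulKf a0) (poch_succl a n) => ->; ring.
Qed.

Lemma hypF_b a b c n : b != 0 -> hypF a (b + 1) c n = hypF a b c n * ((b + n%:R) / b).
Proof. by move=> b0; rewrite ![hypF a _ _ _]hypF_sym hypF_a. Qed.

Lemma hypF_c a b c n : c != 0 ->
  hypF a b (c + 1) n = hypF a b c n * (c / (c + n%:R)).
Proof.
move=> c0; rewrite /hypF; have := canRL (mulKf c0) (poch_succl c n) => ->.
rewrite !invfM invrK; ring.
Qed.

Lemma hypF_pred_c a b c n : notInt c ->
  hypF a b (c - 1) n = hypF a b c n * ((c - 1 + n%:R) / (c - 1)).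
Proof.
move=> hc; have hc1 : notInt (c - 1) := notIntD (-1) hc.
have cn := notInt_neq0n n hc1.
have c10 : c - 1 != 0 by have := notInt_neq0 0 hc1; rewrite addr0.
by rewrite -{2}(subrK 1 c) hypF_c //; field; rewrite cn c10.
Qed.

Lemma hypF_111 a b c n : notInt a -> notInt b -> notInt c ->
  hypF (a + 1) (b + 1) (c + 1) n =
  hypF a b c n * ((a + n%:R) * (b + n%:R) * c / (a * b * (c + n%:R))).
Proof.
move=> ha hb hc; have cn := notInt_neq0n n hc.
have [a0 b0 c0] : [/\ a != 0, b != 0 & c != 0].
  by have := notInt_neq0 0 ha; have := notInt_neq0 0 hb; have := notInt_neq0 0 hc; rewrite !addr0.
by rewrite hypF_a // hypF_b // hypF_c //; field; rewrite a0 b0 cn.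
Qed.


Section Relations.
Variables a b c : K.
Hypotheses (ha : notInt a) (hb : notInt b) (hc : notInt c).

Let a0 : a != 0. Proof. by have := notInt_neq0 0 ha; rewrite addr0. Qed.
Let b0 : b != 0. Proof. by have := notInt_neq0 0 hb; rewrite addr0. Qed.
Let c0 : c != 0. Proof. by have := notInt_neq0 0 hc; rewrite addr0. Qed.
Let a1 : a + 1 != 0. Proof. exact: (notInt_neq0 1 ha). Qed.
Let c1 : c - 1 != 0. Proof. exact: (notInt_neq0 (-1) hc). Qed.
Let cn n : c + n%:R != 0. Proof. exact: (notInt_neq0 n hc). Qed.
Let cn1 n : c + n.+1%:R != 0. Proof. exact: (notInt_neq0 n.+1 hc). Qed.

Let F211 n : hypF (a + 2) (b + 1) (c + 1) n =
  hypF a b c n * ((a + n%:R) * (b + n%:R) * c / (a * b * (c + n%:R)))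
  * ((a + 1 + n%:R) / (a + 1)).
Proof.
rewrite (_ : a + 2 = a + 1 + 1); last by ring.
by rewrite (hypF_a _ _ _ a1) hypF_111.
Qed.

Let F110 n : hypF (a + 1) (b + 1) c n =
  hypF a b c n * ((a + n%:R) * (b + n%:R) / (a * b)).
Proof. by rewrite hypF_a // hypF_b //; field; rewrite a0 b0. Qed.

(** Reduces every shifted coefficient to a rational multiple of [hypF a b c n], so that each
    relation below becomes an identity of rational functions of [n]. *)
Let rule := (F211, F110, (fun n => hypF_111 n ha hb hc), (fun n => hypF_a b c n a0),
  (fun n => hypF_pred_c a b n hc)).

Lemma hyp_rel_a n :
  pmulS (linp 1 0) (hypF (a + 1) b c) n =
  pmulS (linp 1 0) (hypF a b c) n
  + pmulS (linp 0 (b / c)) (hypF (a + 1) (b + 1) (c + 1)) n.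
Proof.
case: n => [|n]; rewrite !pmulS_lin ?rule ?hypFS ?hypF0.
  by field; rewrite ?a0 ?b0 ?c0.
have := natrS_neq0 n; have := cn1 n; rewrite -natr1 => cn1' n1.
by field; rewrite ?a0 ?b0 ?c0 ?cn ?n1 ?cn1'.
Qed.

Lemma hyp_rel_a1 n :
  pmulS (linp (a + 1) (- (a + 1))) (hypF (a + 2) (b + 1) (c + 1)) n =
  pmulS (linp c 0) (hypF a b c) n
  + pmulS (linp (a + 1 - c) b) (hypF (a + 1) (b + 1) (c + 1)) n.
Proof.
case: n => [|n]; rewrite !pmulS_lin ?rule ?hypFS ?hypF0.
  by field; rewrite ?a0 ?b0 ?c0 ?a1.
have := natrS_neq0 n; have := cn1 n; rewrite -natr1 => cn1' n1.
by field; rewrite ?a0 ?b0 ?c0 ?cn ?n1 ?a1 ?cn1'.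
Qed.

Lemma hyp_rel_c n :
  pmulS (linp 1 0) (hypF a b (c - 1)) n =
  pmulS (linp 1 0) (hypF a b c) n
  + pmulS (linp 0 (a * b / (c * (c - 1)))) (hypF (a + 1) (b + 1) (c + 1)) n.
Proof.
case: n => [|n]; rewrite !pmulS_lin ?rule ?hypFS ?hypF0.
  by field; rewrite ?a0 ?b0 ?c0 ?c1.
have := natrS_neq0 n; have := cn1 n; rewrite -natr1 => cn1' n1.
by field; rewrite ?a0 ?b0 ?c0 ?cn ?n1 ?c1 ?cn1'.
Qed.

Lemma hyp_rel_c1 n :
  pmulS (linp 1 (-1)) (hypF (a + 1) (b + 1) c) n =
  pmulS (linp 1 0) (hypF a b c) n
  + pmulS (linp 0 ((a + b + 1 - c) / c)) (hypF (a + 1) (b + 1) (c + 1)) n.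
Proof.
case: n => [|n]; rewrite !pmulS_lin ?rule ?hypFS ?hypF0.
  by field; rewrite ?a0 ?b0 ?c0 ?c1.
have := natrS_neq0 n; have := cn1 n; rewrite -natr1 => cn1' n1.
by field; rewrite ?a0 ?b0 ?c0 ?cn ?n1 ?c1 ?cn1'.
Qed.

(** Eliminates [hypF a b c] from the two previous relations for [a]: this inverts the shift, as the
    descending half of the existence induction needs. *)
Lemma hyp_rel_a_inv n :
  pmulS (linp (a + 1 - c) 0) (hypF (a + 1) (b + 1) (c + 1)) n =
  pmulS (linp (a + 1) (- (a + 1))) (hypF (a + 2) (b + 1) (c + 1)) n
  + pmulS (linp (- c) 0) (hypF (a + 1) b c) n.
Proof.
rewrite hyp_rel_a1; have := hyp_rel_a n; rewrite !pmulS_lin mul1r mul0r addr0 => ->.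
by field.
Qed.

Lemma hyp_rel_c_inv n :
  pmulS (linp 0 ((a + 1 - c) * (b + 1 - c))) (hypF (a + 1) (b + 1) (c + 1)) n =
  pmulS (linp (- (c * (c - 1))) (c * (c - 1))) (hypF (a + 1) (b + 1) c) n
  + pmulS (linp (c * (c - 1)) 0) (hypF a b (c - 1)) n.
Proof.
have -> f : pmulS (linp (- (c * (c - 1))) (c * (c - 1))) f n
    = - (c * (c - 1)) * pmulS (linp 1 (-1)) f n by rewrite !pmulS_lin; ring.
rewrite hyp_rel_c1.
have := hyp_rel_c n; rewrite !pmulS_lin mul1r mul0r addr0 => ->.
by field; rewrite c0 c1.
Qed.

Lemma hyp_rel_base n (f g : nat -> K) u :
  pmulS (linp 1 0) f n = pmulS (linp 1 0) g n + pmulS (linp 0 u) (hypF (a + 1) (b + 1) (c + 1)) n ->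
  pmulS (linp 1 0) g n = pmulS (linp 1 0) f n + pmulS (linp 0 (- u)) (hypF (a + 1) (b + 1) (c + 1)) n.
Proof. by rewrite !pmulS_lin => ->; ring. Qed.

End Relations.

Lemma hypF_swap a b c : hypF a b c = hypF b a c.
Proof. by apply: functional_extensionality => n; apply: hypF_sym. Qed.

(* The series of coefficients [sum_i (r_i + q_i (n-i)) u_(n-i)], with
   [u = hypF a b c], is [r F + q x F']. Clearing denominators turns its vanishing
   into a polynomial identity in [n]; specialising [n] to a zero of the last
   denominator isolates the lowest coefficients of [q] and [r]. *)
Lemma hypF_theta_free a b c (q r : {poly K}) :
  notInt a -> notInt b -> notInt (c - a) -> notInt (c - b) -> notInt c ->
  (forall n, pmulS q (fun i => i%:R * hypF a b c i) n + pmulS r (hypF a b c) n = 0) ->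
  q = 0 /\ r = 0.
Proof.
move=> ha hb hca hcb hc E; set u := hypF a b c.
have cn n : c + n%:R != 0 := notInt_neq0n n hc.
pose w i t := r`_i + q`_i * t.
suff W i : q`_i = 0 /\ r`_i = 0 by split; apply/polyP => i; rewrite coef0; case: (W i).
elim/ltn_ind: i => I IH.
(* With [N] bounding both degrees, the equation at index [t + N] has the same terms [i <= N] for
   every [t]. *)
have [N [IN qN rN]] : exists N, [/\ I <= N, size q <= N & size r <= N]%N.
  by exists (I + (size q + size r))%N; split; lia.
pose d := (N - I)%N.
(* [A t j / B t 0 j] is the ratio of the coefficients of the series at [t + j] and [t]. [P t] is the
   equation at [t + N], divided by the coefficient at [t] and multiplied by [B t 0 d]; this is a
   common denominator because the terms below [I] vanish by induction. *)
pose A t j := \prod_(e < j) ((a + t + e%:R) * (b + t + e%:R)).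
pose B t j d := \prod_(j <= e < d) ((c + t + e%:R) * (1 + t + e%:R)).
pose P t := \sum_(i < N.+1) w i (t + (N - i)%:R) * A t (N - i)%N * B t (N - i)%N d.
have uA t j : u (t + j)%N * B t%:R 0%N j = u t * A t%:R j.
  rewrite /A /B; elim: j => [|j IHj]; first by rewrite addn0 big_ord0 big_geq.
  rewrite addnS /u hypFS -/u big_nat_recr //= big_ord_recr /= [in RHS]mulrA -IHj.
  have := cn (t + j)%N; have := natrS_neq0 (t + j); rewrite -natr1 natrD => n1 c1.
  by field; rewrite n1 c1.
have u0 t : u t != 0.
  rewrite /u; elim: t => [|t IHt]; first by rewrite hypF0 oner_neq0.
  rewrite hypFS; apply: mulf_neq0 => //; apply: mulf_neq0; rewrite ?invr_eq0.
    by apply: mulf_neq0; apply: notInt_neq0n.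
  by apply: mulf_neq0; [apply: notInt_neq0n|apply: natrS_neq0].
have P0 (t : nat) : P t%:R = 0.
  have : \sum_(i < N.+1) w i (t%:R + (N - i)%:R) * u (t + (N - i))%N = 0.
    rewrite -[RHS](E (t + N)%N) -big_split /=.
    pose g i := q`_i * ((t + N - i)%:R * u (t + N - i)%N) + r`_i * u (t + N - i)%N.
    have le : (N.+1 <= (t + N).+1)%N by rewrite ltnS leq_addl.
    transitivity (\sum_(i < N.+1) g i).
      apply: eq_bigr => i _; have iN : (i <= N)%N by rewrite -ltnS.
      by rewrite /g /w -addnBA // natrD; move: (u _) (_ + _%:R) => v y; ring.
    rewrite (big_ord_widen _ g le) big_mkcond /=; apply: eq_bigr => i _.
    case: ltnP => // Ni; rewrite -/u !nth_default ?mul0r ?addr0 //; exact: leq_trans (ltnW Ni).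
  move=> /(congr1 (fun y => y * (B t%:R 0%N d / u t))); rewrite mul0r => <-.
  rewrite mulr_suml; apply: eq_bigr => i _.
  case: (ltnP i I) => iI; first by case: (IH _ iI) => q0 r0; rewrite /w q0 r0; ring.
  have Nid : (N - i <= d)%N by rewrite leq_sub2l.
  have -> : B t%:R 0%N d = B t%:R 0%N (N - i)%N * B t%:R (N - i)%N d.
    by rewrite /B -big_cat_nat.
  have := uA t (N - i)%N; have := u0 t.
  move: (u t) (u (t + _)%N) (B _ (N - i)%N d) (B _ _ _) (A _ _) (w _ _) => v v' B1 B0 A0 w0 vn e.
  transitivity (w0 * (v' * B0) * B1 / v); last by ring.
  by rewrite e; field.
pose wp i : {poly K} := (r`_i)%:P + q`_i *: ('X + (N - i)%:R%:P).
pose lp (y : K) (e : nat) : {poly K} := 'X + (y + e%:R)%:P.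
pose PP : {poly K} := \sum_(i < N.+1) wp i * \prod_(e < N - i) (lp a e * lp b e)
  * \prod_(N - i <= e < d) (lp c e * lp 1 e).
have PPE t : PP.[t] = P t.
  have lpE y e : (lp y e).[t] = y + t + e%:R by rewrite /lp hornerD hornerX hornerC; ring.
  rewrite /PP horner_sum; apply: eq_bigr => i _; rewrite !hornerM !horner_prod.
  congr (_ * _ * _); first by rewrite /wp /w !(hornerD, hornerZ, hornerX, hornerC).
    by apply: eq_bigr => e _; rewrite hornerM !lpE.
  by apply: eq_bigr => e _; rewrite hornerM !lpE.
(* A polynomial vanishing at all natural numbers is zero in characteristic 0, so [t] may now be any
   element of [K]. *)
have Pz t : P t = 0.
  suff PP0 : PP = 0 by rewrite -PPE PP0 horner0.
  apply/eqP; apply: contraT => PP0.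
  pose s : seq K := [seq i%:R | i <- iota 0 (size PP)].
  have := max_poly_roots PP0 (rs := s); rewrite size_map size_iota ltnn; apply.
    by apply/allP => y /mapP[i _ ->]; rewrite /root PPE P0.
  rewrite map_inj_uniq ?iota_uniq //.
  have inj i j : (i <= j)%N -> i%:R = j%:R :> K -> i = j.
    move=> ij /eqP; rewrite eq_sym -subr_eq0 -natrB // ((pcharf0P K).1 char0) subn_eq0 => ji.
    by apply/eqP; rewrite eqn_leq ij.
  by move=> i j e; case: (leqP i j) => ij; [apply: inj|apply/esym/inj; rewrite // ltnW].
(* This product is the last factor of the denominator; it occurs in every term with [i > I] and is
   absent from the term [I]. *)
have key t : (c + t + d%:R - 1) * (t + d%:R) = 0 -> w I (t + d%:R) * A t d = 0.
  move=> z; have ltIN : (I < N.+1)%N by rewrite ltnS.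
  have := Pz t; rewrite /P (bigD1 (Ordinal ltIN)) //= {1}/B big_geq // mulr1.
  rewrite big1 ?addr0 // => i; rewrite -val_eqE /= => iI.
  case: (ltnP i I) => [lt|ge]; first by case: (IH _ lt) => q0 r0; rewrite /w q0 r0; ring.
  have {iI ge} lt : (I < i)%N by rewrite ltn_neqAle eq_sym iI.
  have iN : (i <= N)%N by rewrite -ltnS.
  have [d' dE] : exists d', d = d'.+1 by exists d.-1; rewrite prednK // /d; lia.
  rewrite /B dE big_nat_recr /=; last by rewrite -ltnS -dE /d; lia.
  move: z; rewrite dE -natr1 => z.
  rewrite (_ : (c + t + d'%:R) * (1 + t + d'%:R) = 0) ?mulr0 // -[RHS]z; ring.
(* At [t = - d] the weight [w I (t + d)] is the coefficient of [r] alone. *)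
have rI : r`_I = 0.
  have := key (- d%:R); rewrite addNr mulr0 => /(_ erefl) /eqP.
  rewrite /w mulr0 addr0 mulf_eq0 => /orP[/eqP //|].
  suff nz : A (- d%:R) d != 0 by move/negP: nz.
  apply/prodf_neq0 => e _; apply: mulf_neq0.
    by rewrite -addrA; have := notInt_neq0 (e%:Z - d%:Z) ha; rewrite intrB [_ - d%:~R]addrC.
  by rewrite -addrA; have := notInt_neq0 (e%:Z - d%:Z) hb; rewrite intrB [_ - d%:~R]addrC.
(* At [t = 1 - c - d] the weight is [1 - c] times the coefficient of [q], and [A] is nonzero there
   because [c - a] and [c - b] are not integers. *)
split=> //; have := key (1 - c - d%:R); rewrite subrK.
rewrite (_ : c + (1 - c - d%:R) + d%:R - 1 = 0) ?mul0r; last by ring.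
move=> /(_ erefl) /eqP; rewrite /w rI add0r !mulf_eq0 -orbA => /or3P[/eqP //||].
  rewrite -oppr_eq0 opprB; have := notInt_neq0 (-1) hc => nz z; by rewrite z in nz.
suff nz : A (1 - c - d%:R) d != 0 by move/negP: nz.
apply/prodf_neq0 => e _; apply: mulf_neq0.
  rewrite (_ : _ + _ = - (c - a + (d%:Z - e%:Z - 1)%:~R)) ?oppr_eq0 ?notInt_neq0 // !intrB; ring.
rewrite (_ : _ + _ = - (c - b + (d%:Z - e%:Z - 1)%:~R)) ?oppr_eq0 ?notInt_neq0 // !intrB; ring.
Qed.

(** The derivative formula [x F(a+1, b+1, c+1) = c / (a b) x F'] turns a relation between the two
    series, multiplied by [x], into one between [F] and [x F']. *)
Lemma hypF_free a b c : standing a b c ->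
  series_free (hypF a b c) (hypF (a + 1) (b + 1) (c + 1)).
Proof.
move=> [ha [hb [hca [hcb [hc _]]]]] q r E.
have [a0 b0 c0] : [/\ a != 0, b != 0 & c != 0].
  by have := notInt_neq0 0 ha; have := notInt_neq0 0 hb; have := notInt_neq0 0 hc; rewrite !addr0.
have k0 : c / (a * b) != 0 by rewrite !mulf_neq0 ?invr_eq0 ?mulf_neq0.
have theta i : pmulS (c / (a * b))%:P (fun i => i%:R * hypF a b c i) i
    = pmulS 'X (hypF (a + 1) (b + 1) (c + 1)) i.
  rewrite -[_%:P]addr0 -(scale0r 'X) -/(linp _ _) pmulS_lin pmulSX mul0r addr0.
  case: i => [|i]; first by rewrite mul0r mulr0.
  rewrite hypF_111 // hypFS -natr1.
  have := notInt_neq0n i hc; have := natrS_neq0 i; rewrite -natr1 => i1 ci.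
  by field; rewrite a0 b0 i1 ci.
have [] := hypF_theta_free (q := q * (c / (a * b))%:P) (r := r * 'X) ha hb hca hcb hc.
  move=> n; rewrite !pmulS_mulp (eq_pmulS _ theta).
  rewrite ![pmulS _ (pmulS 'X _) n]pmulSC !pmulSX.
  by case: n => [|n]; rewrite ?addr0.
move=> /eqP; rewrite mulf_eq0 polyC_eq0 (negbTE k0) orbF => /eqP ->.
by move=> /eqP; rewrite mulf_eq0 polyX_eq0 orbF => /eqP ->.
Qed.

Lemma standing_shift a b c (k l m : int) :
  standing a b c -> standing (a + k%:~R) (b + l%:~R) (c + m%:~R).
Proof.
move=> [ha [hb [hca [hcb [hc [hcab hab]]]]]]; repeat split; try exact: notIntD.
- rewrite (_ : _ - _ = c - a + (m - k)%:~R); last by rewrite intrB; ring.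
  exact: notIntD.
- rewrite (_ : _ - _ = c - b + (m - l)%:~R); last by rewrite intrB; ring.
  exact: notIntD.
- rewrite (_ : _ - _ = c - a - b + (m - k - l)%:~R); last by rewrite !intrB; ring.
  exact: notIntD.
- rewrite (_ : _ - _ = a - b + (k - l)%:~R); last by rewrite intrB; ring.
  exact: notIntD.
Qed.

(** * Existence of the coefficients *)

Section Existence.
Variables a b c : K.
Hypothesis st : standing a b c.

Local Notation spanned k l m := (exists Q R, contig_rel k l m a b c Q R).

Let F k l m := hypF (a + k%:~R) (b + l%:~R) (c + m%:~R).

Let span_step (k l m k1 l1 m1 k2 l2 m2 : int) p p1 p2 :
  p != 0 ->
  (forall n, pmulS p (F k l m) n = pmulS p1 (F k1 l1 m1) n + pmulS p2 (F k2 l2 m2) n) ->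
  spanned k1 l1 m1 -> spanned k2 l2 m2 -> spanned k l m.
Proof.
move=> p0 E [Q1 [R1 h1]] [Q2 [R2 h2]].
by eexists; eexists; apply: (span_rel_comb p0 E h1 h2).
Qed.

(** The same induction as for [contiguous_eq0], with being spanned in place of vanishing: asked of
    the pair, the property is carried both ways by each unit shift. *)
Lemma contig_rel_exists k l m : spanned k l m.
Proof.
have two (y : K) (i : int) : y + (i + 1 + 1)%:~R = y + i%:~R + 2.
  by rewrite !intr_succ; ring.
have one (y : K) (i : int) : y + (i + 1)%:~R = y + i%:~R + 1.
  by rewrite intr_succ addrA.
have mone (y : K) (i : int) : y + (i - 1)%:~R = y + i%:~R - 1.
  by rewrite intr_pred addrA.
have nz1 : (1 : K) != 0 by rewrite oner_neq0.
suff: spanned k l m /\ spanned (k + 1) (l + 1) (m + 1) by case.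
move: k l m; apply: int3_ind_iff => [|k l m|k l m|k l m].
- split; [exists 0, 1|exists 1, 0].
    by have := span_rel_base0 (hypF a b c) (hypF (a + 1) (b + 1) (c + 1)); rewrite /contig_rel !addr0.
  exact: (span_rel_base1 (hypF a b c) (hypF (a + 1) (b + 1) (c + 1))).
- have [ha [hb [hca [hcb [hc _]]]]] := standing_shift k l m st.
  have a1 := notInt_neq0 1 ha.
  have ac : a + k%:~R + 1 - (c + m%:~R) != 0.
    by rewrite (_ : _ - _ = - (c + m%:~R - (a + k%:~R) + (-1)%:~R)) ?oppr_eq0 ?notInt_neq0 //; ring.
  split=> -[h0 h1].
    split.
      apply: (span_step (linp_neq0 0 nz1)) h0 h1 => n.
      rewrite /F !one; exact: hyp_rel_a.
    apply: (span_step (linp_neq0 _ a1)) h0 h1 => n.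
    rewrite /F two !one; exact: hyp_rel_a1.
  have h2 : spanned (k + 1) (l + 1) (m + 1).
    apply: (span_step (linp_neq0 0 ac)) h1 h0 => n.
    rewrite /F two !one; exact: hyp_rel_a_inv.
  split=> //; apply: (span_step (linp_neq0 0 nz1)) h0 h2 => n.
  rewrite /F !one; apply: hyp_rel_base; exact: hyp_rel_a.
- have [ha [hb [hca [hcb [hc _]]]]] := standing_shift k l m st.
  have b1 := notInt_neq0 1 hb.
  have bc : b + l%:~R + 1 - (c + m%:~R) != 0.
    by rewrite (_ : _ - _ = - (c + m%:~R - (b + l%:~R) + (-1)%:~R)) ?oppr_eq0 ?notInt_neq0 //; ring.
  (* The relations in [b] are those in [a] for the series with its upper parameters exchanged. *)
  have Fs k' l' m' : F k' l' m' = hypF (b + l'%:~R) (a + k'%:~R) (c + m'%:~R) by apply: hypF_swap.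
  split=> -[h0 h1].
    split.
      apply: (span_step (linp_neq0 0 nz1)) h0 h1 => n.
      rewrite !Fs !one; exact: hyp_rel_a.
    apply: (span_step (linp_neq0 _ b1)) h0 h1 => n.
    rewrite !Fs two !one; exact: hyp_rel_a1.
  have h2 : spanned (k + 1) (l + 1) (m + 1).
    apply: (span_step (linp_neq0 0 bc)) h1 h0 => n.
    rewrite !Fs two !one; exact: hyp_rel_a_inv.
  split=> //; apply: (span_step (linp_neq0 0 nz1)) h0 h2 => n.
  rewrite !Fs !one; apply: hyp_rel_base; exact: hyp_rel_a.
- have [ha [hb [hca [hcb [hc _]]]]] := standing_shift k l m st.
  have ac : a + k%:~R + 1 - (c + m%:~R) != 0.
    by rewrite (_ : _ - _ = - (c + m%:~R - (a + k%:~R) + (-1)%:~R)) ?oppr_eq0 ?notInt_neq0 //; ring.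
  have bc : b + l%:~R + 1 - (c + m%:~R) != 0.
    by rewrite (_ : _ - _ = - (c + m%:~R - (b + l%:~R) + (-1)%:~R)) ?oppr_eq0 ?notInt_neq0 //; ring.
  rewrite subrK; split=> -[h0 h1].
    split.
      apply: (span_step (linp_neq0 0 nz1)) h0 h1 => n.
      rewrite /F mone !one; exact: hyp_rel_c.
    apply: (span_step (linp_neq0 _ nz1)) h0 h1 => n.
    rewrite /F !one; exact: hyp_rel_c1.
  have h2 : spanned (k + 1) (l + 1) (m + 1).
    apply: (span_step (linp_neq0r 0 (mulf_neq0 ac bc))) h1 h0 => n.
    rewrite /F mone !one; exact: hyp_rel_c_inv.
  split=> //; apply: (span_step (linp_neq0 0 nz1)) h0 h2 => n.
  rewrite /F mone !one; apply: hyp_rel_base; exact: hyp_rel_c.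
Qed.

End Existence.
End Hypergeometric.

(** * The group generated by the four involutions *)

(** Indices from 3 on all denote [sig3], so that every list of naturals is a word. *)
Definition gen_sig (i : nat) : Spt -> Spt :=
  match i with 0%N => sig0 | 1%N => sig1 | 2%N => sig2 | _ => sig3 end.

Definition word_map (w : seq nat) (z : Spt) : Spt := foldr gen_sig z w.

Lemma gen_sigK i : involutive (gen_sig i).
Proof.
case: i => [|[|[|i]]] [k l m [? ? ? ?] [? ? ? ?] [? ? ? ?] x];
  rewrite /= /sig0 /sig1 /sig2 /sig3 /saddS /soppS /sconst //=;
  f_equal; try (f_equal; ring); try ring; by case: x.
Qed.

Lemma word_map_cat u v z : word_map (u ++ v) z = word_map u (word_map v z).
Proof. by rewrite /word_map foldr_cat. Qed.

Lemma word_map_rev w : cancel (word_map w) (word_map (rev w)).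
Proof.
elim: w => //= i w IH z; rewrite -cat1s rev_cat word_map_cat /=.
by rewrite gen_sigK IH.
Qed.

(** The generators are involutions, so the inverse of a word is its reversal. *)
Lemma GtP f : Gt f <-> exists w, f = word_map w.
Proof.
split.
  elim=> [||||| {}f g _ [u ->] _ [v ->]| {}f g _ [w ->] fg gf].
  - by exists [:: 0%N].
  - by exists [:: 1%N].
  - by exists [:: 2%N].
  - by exists [:: 3%N].
  - by exists [::].
  - by exists (u ++ v); apply: functional_extensionality => z; rewrite word_map_cat.
  - exists (rev w); apply: functional_extensionality => z.
    by rewrite -[in RHS](gf z) word_map_rev.
case=> w ->; elim: w => [|i w IH]; first exact: Gt_id.
have Gi : Gt (gen_sig i).
  by case: i => [|[|[|i]]]; [exact: Gt_sig0|exact: Gt_sig1|exact: Gt_sig2|exact: Gt_sig3].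
exact: (Gt_comp Gi IH).
Qed.

(** The injection into [nat] gives [Sx] a computable equality, used to index tables and to compare
    codes. *)
Definition nat_of_Sx (s : Sx) : nat :=
  match s with Sx_x => 0 | Sx_xx1 => 1 | Sx_1mx => 2 | Sx_x1x => 3 | Sx_inv => 4
  | Sx_inv1mx => 5 end.
Definition Sx_of_nat (n : nat) : Sx :=
  match n with 0 => Sx_x | 1 => Sx_xx1 | 2 => Sx_1mx | 3 => Sx_x1x | 4 => Sx_inv
  | _ => Sx_inv1mx end%N.
Lemma nat_of_SxK : cancel nat_of_Sx Sx_of_nat. Proof. by case. Qed.
HB.instance Definition _ := Equality.copy Sx (can_type nat_of_SxK).

(* An element of the group acts on [(k, l, m)] by integral affine forms, encoded
   by their coefficients on [1, k, l, m]; on [(s1, s2, s3)] by integral linear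
   forms plus a constant affine in [k, l, m]; and on [sx] by a table listing the
   images of the six elements of [Sx]. *)
Definition aform := (int * int * int * int)%type.
Definition sform := (int * int * int * aform)%type.
Definition code := (aform * aform * aform * (sform * sform * sform) * seq Sx)%type.

Definition aconst (n : int) : aform := (n, 0, 0, 0).
Definition aadd (u v : aform) : aform :=
  let: (u0, u1, u2, u3) := u in let: (v0, v1, v2, v3) := v in
  (u0 + v0, u1 + v1, u2 + v2, u3 + v3).
Definition aopp (u : aform) : aform :=
  let: (u0, u1, u2, u3) := u in (- u0, - u1, - u2, - u3).
Definition aeval (z : Spt) (u : aform) : int :=
  let: (u0, u1, u2, u3) := u in u0 + u1 * sk z + u2 * sl z + u3 * sm z.

Definition sofa (u : aform) : sform := (0, 0, 0, u).
Definition sadd (u v : sform) : sform :=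
  let: (u1, u2, u3, u0) := u in let: (v1, v2, v3, v0) := v in
  (u1 + v1, u2 + v2, u3 + v3, aadd u0 v0).
Definition sopp (u : sform) : sform :=
  let: (u1, u2, u3, u0) := u in (- u1, - u2, - u3, aopp u0).
Definition seval (z : Spt) (u : sform) : Sabc :=
  let: (u1, u2, u3, u0) := u in
  let lin (p : Sabc -> int) := u1 * p (s1 z) + u2 * p (s2 z) + u3 * p (s3 z) in
  mkSabc (lin n0 + aeval z u0) (lin n1) (lin n2) (lin n3).

Definition all_Sx := [:: Sx_x; Sx_xx1; Sx_1mx; Sx_x1x; Sx_inv; Sx_inv1mx].

Definition code_map (d : code) (z : Spt) : Spt :=
  let: (k, l, m, (a, b, c), t) := d in
  mkS (aeval z k) (aeval z l) (aeval z m) (seval z a) (seval z b) (seval z c)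
      (nth Sx_x t (index (sx z) all_Sx)).

Definition code_id : code :=
  ((0, 1, 0, 0), (0, 0, 1, 0), (0, 0, 0, 1),
   ((1, 0, 0, aconst 0), (0, 1, 0, aconst 0), (0, 0, 1, aconst 0)), all_Sx).

Definition code_sig (i : nat) (d : code) : code :=
  let: (k, l, m, (a, b, c), t) := d in
  match i with
  | 0%N => let f u := aadd (aconst 2) (aopp u) in
           let g u v := sadd u (sofa (aadd v (aconst (-1)))) in
           (f k, f l, f m, (g a k, g b l, g c m), t)
  | 1%N => (aadd (aadd m (aconst 1)) (aopp k), l, m,
            (sadd (sadd c (sopp a)) (sofa (aconst (-1))), b, c), map sx_div t)
  | 2%N => (k, l, aadd (aadd k l) (aopp m),
            (a, b, sadd (sadd (sadd a b) (sofa (aconst 1))) (sopp c)), map sx_1m t)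
  | _ => (l, k, m, (b, a, c), t)
  end.

Lemma aevalD z u v : aeval z (aadd u v) = aeval z u + aeval z v.
Proof. case: u => [[[? ?] ?] ?]; case: v => [[[? ?] ?] ?] /=; ring. Qed.
Lemma aevalN z u : aeval z (aopp u) = - aeval z u.
Proof. case: u => [[[? ?] ?] ?] /=; ring. Qed.
Lemma aevalC z n : aeval z (aconst n) = n.
Proof. rewrite /=; ring. Qed.
Lemma sevalD z u v : seval z (sadd u v) = saddS (seval z u) (seval z v).
Proof.
case: u => [[[? ?] ?] ?]; case: v => [[[? ?] ?] ?] /=.
by rewrite aevalD /saddS /=; f_equal; ring.
Qed.
Lemma sevalN z u : seval z (sopp u) = soppS (seval z u).
Proof. by case: u => [[[? ?] ?] ?] /=; rewrite aevalN /soppS /=; f_equal; ring. Qed.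
Lemma sevalA z u : seval z (sofa u) = sconst (aeval z u).
Proof. by rewrite /= /sconst; f_equal; ring. Qed.

(** A full table guarantees that the lookup in [code_map] never falls back on its default value. *)
Definition wf_code (d : code) := size d.2 == 6%N.

Lemma code_sig_wf i d : wf_code d -> wf_code (code_sig i d).
Proof.
by case: d => [[[[k l] m] [[a b] c]] t]; rewrite /wf_code;
   case: i => [|[|[|i]]] //=; rewrite size_map.
Qed.

Lemma code_map_sig i d z :
  wf_code d -> code_map (code_sig i d) z = gen_sig i (code_map d z).
Proof.
case: d => [[[[k l] m] [[a b] c]] t] /eqP szt; rewrite [_.2]/= in szt.
have ix : (index (sx z) all_Sx < size t)%N by rewrite szt; case: (sx z).
case: i => [|[|[|i]]];
  rewrite /code_map /code_sig /gen_sig /sig0 /sig1 /sig2 /sig3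
    ?(nth_map Sx_x) // ?(aevalD, aevalN, aevalC, sevalD, sevalN, sevalA) //.
Qed.

Lemma code_map_id z : code_map code_id z = z.
Proof.
case: z => k l m [? ? ? ?] [? ? ? ?] [? ? ? ?] x.
rewrite /code_map /=; f_equal; try ring; try (f_equal; ring).
by case: x.
Qed.

Definition word_code (w : seq nat) : code := foldr code_sig code_id w.

Lemma word_code_wf w : wf_code (word_code w).
Proof. by elim: w => //= i w IH; apply: code_sig_wf. Qed.

Lemma code_map_word w : code_map (word_code w) = word_map w.
Proof.
apply: functional_extensionality => z.
elim: w => [|i w IH] /=; first exact: code_map_id.
by rewrite code_map_sig ?word_code_wf // IH.
Qed.

(* [sig1], [sig2], [sig3] generate a Coxeter group of type B3 (with [sig1] the
   middle node); these are the products of minimal coset representatives for the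
   chain of parabolic subgroups, times the powers of the commuting [sig0]. *)
Definition group_words : seq (seq nat) :=
  [seq u ++ v | u <- [:: [::]; [:: 2]; [:: 1; 2]; [:: 3; 1; 2]; [:: 1; 3; 1; 2];
                         [:: 2; 1; 3; 1; 2]],
     v <- [seq v ++ w | v <- [:: [::]; [:: 1]; [:: 3; 1]; [:: 1; 3; 1]],
             w <- [:: [::]; [:: 3]; [:: 0]; [:: 3; 0]]]]%N.

Definition group_codes := [seq word_code w | w <- group_words].

(** Upper bound on the order: the list contains the identity and is stable under left composition
    with the generators, so it contains the code of every word. *)
Lemma group_codes_closed :
  all (fun d => all (fun i => code_sig i d \in group_codes) (iota 0 4)) group_codes.
Proof. by vm_compute. Qed.

Lemma word_code_mem w : word_code w \in group_codes.
Proof.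
elim: w => [|i w IH]; first by vm_compute.
have /allP /(_ _ IH) /allP cl := group_codes_closed.
(* Truncation at 3 brings an arbitrary index into the range that was checked by computation. *)
have -> : word_code (i :: w) = code_sig (minn i 3) (word_code w).
  by rewrite /=; case: (word_code w) => [[[[? ?] ?] [[? ?] ?]] ?]; case: i => [|[|[|[|i]]]].
by apply: cl; rewrite mem_iota; lia.
Qed.

Definition Spt_tuple (z : Spt) :=
  let t (u : Sabc) := (n0 u, n1 u, n2 u, n3 u) in
  (sk z, sl z, sm z, t (s1 z), t (s2 z), t (s3 z), sx z).

(** Lower bound on the order: a single point of S already tells the 96 maps apart. *)
Lemma group_codes_separated :
  uniq [seq Spt_tuple (code_map d (z0 0 0 0)) | d <- group_codes].
Proof. by vm_compute. Qed.

Lemma Gt_card : exists e : 'I_96 -> (Spt -> Spt),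
  injective e /\ forall f, Gt f <-> exists i, f = e i.
Proof.
have sz : size group_words = 96%N by [].
exists (fun i => word_map (nth [::] group_words i)); split.
  move=> i j eqij; apply: val_inj; apply/eqP => /=.
  pose f w := Spt_tuple (code_map (word_code w) (z0 0 0 0)).
  have u : uniq (map f group_words).
    by have := group_codes_separated; rewrite /group_codes -map_comp.
  have [li lj] : (i < size (map f group_words))%N /\ (j < size (map f group_words))%N.
    have szf : size (map f group_words) = 96%N := etrans (size_map _ _) sz.
    by split; rewrite szf; exact: ltn_ord.
  rewrite -(nth_uniq (f [::]) li lj u); rewrite size_map in li lj.
  by rewrite (nth_map [::] _ _ li) (nth_map [::] _ _ lj) /f !code_map_word eqij.
move=> f; rewrite GtP; split; last by case=> i ->; eexists.
case=> w ->; have /mapP[v vin eqwv] := word_code_mem w.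
have iv : (index v group_words < 96)%N by rewrite -sz index_mem.
exists (Ordinal iv); rewrite /= nth_index //.
by rewrite -code_map_word eqwv code_map_word.
Qed.

(** * Rational functions and substitution *)

HB.instance Definition _ (K : fieldType) :=
  GRing.RMorphism.copy (@cstF K) (@FracField.tofrac {poly K} \o @polyC K).

(** Expresses the Pfaff substitution through [1 - y] and inversion, both of which preserve
    transcendence. *)
Lemma pfaff_mobius (F : fieldType) (y : F) : 1 - y != 0 -> y / (y - 1) = 1 - (1 - y)^-1.
Proof.
move=> y1; have y1' : y - 1 != 0 by rewrite -oppr_eq0 opprB.
by field; rewrite y1 y1'.
Qed.

Lemma sub_div (F : fieldType) (p q p' q' : F) :
  q != 0 -> q' != 0 -> p / q - p' / q' = (p * q' - p' * q) / (q * q').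
Proof. by move=> q0 q'0; field; rewrite q0 q'0. Qed.

Section RatFun.
Variable K : fieldType.
Local Notation tofrac := (@FracField.tofrac {poly K}).
Local Notation X := (varX K).
Implicit Types (f g be : ratfun K) (p q : {poly K}).

Lemma frac_repr f : exists p q, q != 0 /\ f = tofrac p / tofrac q.
Proof.
elim/quotW: f => x; exists (\n_x), (\d_x); split; first exact: denom_ratioP.
have d0 := denom_ratioP x.
apply: (canRL (mulfK _)); first by rewrite tofrac_eq0.
rewrite -[GRing.mul _ _]/(FracField.mul _ _) !piE; apply/eqmodP => /=.
by rewrite FracField.equivfE !numden_Ratio ?mulr1 ?oner_neq0 // mulrC.
Qed.

Lemma cstFD (u v : K) : cstF (u + v) = cstF u + cstF v. Proof. exact: rmorphD. Qed.
Lemma cstFN (u : K) : cstF (- u) = - cstF u. Proof. exact: rmorphN. Qed.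
Lemma cstFB (u v : K) : cstF (u - v) = cstF u - cstF v. Proof. exact: rmorphB. Qed.
Lemma cstFM (u v : K) : cstF (u * v) = cstF u * cstF v. Proof. exact: rmorphM. Qed.
Lemma cstFV (u : K) : cstF u^-1 = (cstF u)^-1. Proof. exact: fmorphV. Qed.
Lemma cstF0 : cstF 0 = 0 :> ratfun K. Proof. exact: rmorph0. Qed.
Lemma cstF1 : cstF 1 = 1 :> ratfun K. Proof. exact: rmorph1. Qed.
Lemma cstF_int n : cstF n%:~R = n%:~R :> ratfun K. Proof. exact: rmorph_int. Qed.
Lemma cstF_nat n : cstF n%:R = n%:R :> ratfun K. Proof. exact: rmorph_nat. Qed.

Lemma cstF_eq0 (u : K) : (cstF u == 0) = (u == 0).
Proof. by rewrite tofrac_eq0 polyC_eq0. Qed.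

Lemma tofrac_linp (u v : K) : tofrac (linp u v) = cstF u + cstF v * X.
Proof. by rewrite /linp -mul_polyC tofracD tofracM. Qed.

Lemma cstF_notInt (u : K) : notInt u -> notInt (cstF u).
Proof.
move=> h n; rewrite -subr_eq0 -cstF_int -cstFB cstF_eq0.
by rewrite subr_eq0.
Qed.

Lemma cstF_standing (a b c : K) : standing a b c -> standing (cstF a) (cstF b) (cstF c).
Proof.
by move=> [? [? [? [? [? [? ?]]]]]]; repeat split; rewrite -?cstFB;
   apply: cstF_notInt.
Qed.

Lemma cstF_poch (u : K) n : cstF (poch u n) = poch (cstF u) n.
Proof.
case: n => n; rewrite /poch ?cstFV (rmorph_prod (@cstF K)).
  by apply: eq_bigr => i _; rewrite -[LHS]/(cstF (u + i%:R)) cstFD cstF_nat.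
congr (_^-1); apply: eq_bigr => i _.
by rewrite -[LHS]/(cstF (u - i.+1%:R)) cstFB cstF_nat.
Qed.

Lemma horner_varX p : (map_poly (@cstF K) p).[X] = tofrac p.
Proof.
have -> : map_poly (@cstF K) p = map_poly tofrac (map_poly polyC p).
  by rewrite -map_poly_comp.
rewrite /varX horner_map; congr (tofrac _).
by rewrite -[RHS]comp_polyXr.
Qed.

(** The condition under which no denominator dies when [be] is substituted for the variable, so that
    [fsubst be] is a field morphism. *)
Definition transcendental be :=
  forall q, q != 0 -> (map_poly (@cstF K) q).[be] != 0.

(** Gives access to the closure of algebraic elements under subtraction and inversion. *)
Lemma transcendentalP be : transcendental be <-> ~ algebraicOver (@cstF K) be.
Proof.
split=> [tr [q q0 /rootP qbe]|na q q0]; first by have /eqP := tr q q0.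
by apply/negP => qbe; apply: na; exists q.
Qed.

Lemma transcendentalX : transcendental X.
Proof. by move=> q q0; rewrite horner_varX tofrac_eq0. Qed.

Lemma transcendentalB be : transcendental be -> transcendental (1 - be).
Proof.
move=> /transcendentalP na; apply/transcendentalP => al; apply: na.
by have := algebraic_sub (algebraic1 (@cstF K)) al; rewrite (subKr 1 be).
Qed.

Lemma transcendentalV be : transcendental be -> transcendental be^-1.
Proof.
move=> /transcendentalP na; apply/transcendentalP => /algebraic_inv.
by rewrite invrK.
Qed.

Lemma transcendental_neq0 be : transcendental be -> be != 0.
Proof. by move=> /(_ 'X); rewrite polyX_eq0 map_polyX hornerX; apply. Qed.

(** The fraction picked by [epsilon] is arbitrary; cross-multiplication before and after evaluation
    shows that any other gives the same value. *)
Lemma fsubst_frac be p q : transcendental be -> q != 0 ->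
  fsubst be (tofrac p / tofrac q) =
  (map_poly (@cstF K) p).[be] / (map_poly (@cstF K) q).[be].
Proof.
move=> tr q0; rewrite /fsubst.
set pq := epsilon _ _.
have [] : pq.2 != 0 /\ tofrac p / tofrac q = tofrac pq.1 / tofrac pq.2.
  apply: (epsilon_spec (inhabits (0, 1)) (fun pq => pq.2 != 0 /\
    tofrac p / tofrac q = tofrac pq.1 / tofrac pq.2)).
  by exists (p, q).
move: pq => [p' q'] /= q'0 /eqP.
rewrite eqr_div; [|by rewrite tofrac_eq0..]; rewrite -!tofracM tofrac_eq => /eqP e.
apply/eqP; rewrite (eqr_div _ _ (tr _ q'0) (tr _ q0)) -!hornerM -!(rmorphM (map_poly (@cstF K))).
by rewrite -e.
Qed.

Lemma fsubst_morph be : transcendental be ->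
  exists phi : {rmorphism ratfun K -> ratfun K}, fsubst be =1 phi.
Proof.
move=> tr.
pose ev p := (map_poly (@cstF K) p).[be].
have evM p q : ev (p * q) = ev p * ev q by rewrite /ev rmorphM hornerM.
have evB p q : ev (p - q) = ev p - ev q by rewrite /ev rmorphB hornerD hornerN.
have ev1 : ev 1 = 1 by rewrite /ev rmorph1 hornerC.
have fE p q : q != 0 -> fsubst be (tofrac p / tofrac q) = ev p / ev q.
  exact: fsubst_frac.
have zm : zmod_morphism (fsubst be).
  move=> f g; have [p [q [q0 ->]]] := frac_repr f; have [p' [q' [q'0 ->]]] := frac_repr g.
  have [fq fq'] : tofrac q != 0 /\ tofrac q' != 0 by rewrite !tofrac_eq0.
  have -> : tofrac p / tofrac q - tofrac p' / tofrac q'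
      = tofrac (p * q' - p' * q) / tofrac (q * q').
    by rewrite (sub_div _ _ fq fq') tofracB !tofracM.
  rewrite (fE _ _ (mulf_neq0 q0 q'0)) (fE _ _ q0) (fE _ _ q'0) evB !evM.
  by rewrite (sub_div _ _ (tr _ q0) (tr _ q'0)).
have mm : monoid_morphism (fsubst be).
  split; first by rewrite -[X in fsubst _ X](divr1 1) -tofrac1 fE ?oner_neq0 // ev1 divr1 tofrac1.
  move=> f g; have [p [q [q0 ->]]] := frac_repr f; have [p' [q' [q'0 ->]]] := frac_repr g.
  rewrite mulf_div -!tofracM (fE _ _ (mulf_neq0 q0 q'0)) (fE _ _ q0) (fE _ _ q'0) !evM.
  by rewrite mulf_div.
pose m1 := GRing.isZmodMorphism.Build _ _ (fsubst be) zm.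
pose m2 := GRing.isMonoidMorphism.Build _ _ (fsubst be) mm.
pose phi : {rmorphism ratfun K -> ratfun K} := HB.pack (fsubst be) m1 m2.
by exists phi.
Qed.


Lemma fsubst_tofrac be p : transcendental be ->
  fsubst be (tofrac p) = (map_poly (@cstF K) p).[be].
Proof.
move=> tr; have := fsubst_frac p tr (oner_neq0 _).
by rewrite tofrac1 divr1 rmorph1 hornerC divr1.
Qed.

Lemma fsubst_cst be u : transcendental be -> fsubst be (cstF u) = cstF u.
Proof. by move=> tr; rewrite [cstF u in LHS]/cstF fsubst_tofrac // map_polyC hornerC. Qed.

Lemma fsubstX be : transcendental be -> fsubst be X = be.
Proof. by move=> tr; rewrite /varX fsubst_tofrac // map_polyX hornerX. Qed.

Lemma fsubst_horner be ga p : transcendental be ->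
  fsubst be (map_poly (@cstF K) p).[ga] = (map_poly (@cstF K) p).[fsubst be ga].
Proof.
move=> tr; have [phi phiE] := fsubst_morph tr.
rewrite !phiE -horner_map; congr (_.[_]).
rewrite -map_poly_comp; apply: eq_map_poly => u /=.
by rewrite -phiE fsubst_cst.
Qed.

Lemma transcendental_fsubst be ga :
  transcendental be -> transcendental ga -> transcendental (fsubst be ga).
Proof.
move=> tb tg q q0; rewrite -fsubst_horner //.
by have [phi ->] := fsubst_morph tb; rewrite fmorph_eq0 tg.
Qed.

Lemma fsubst_comp be ga f : transcendental be -> transcendental ga ->
  fsubst be (fsubst ga f) = fsubst (fsubst be ga) f.
Proof.
move=> tb tg; have [p [q [q0 ->]]] := frac_repr f.
rewrite (fsubst_frac _ tg q0) (fsubst_frac _ (transcendental_fsubst tb tg) q0).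
rewrite -!fsubst_horner //.
by have [phi phiE] := fsubst_morph tb; rewrite !phiE fmorph_div.
Qed.

End RatFun.

(** * The coefficients of the contiguity relation *)

Section Coefficients.
Variable K : fieldType.
Hypothesis char0 : has_pchar0 K.
Local Notation X := (varX K).

Lemma varX_neq0 : X != 0.
Proof. exact: transcendental_neq0 (@transcendentalX K). Qed.

Lemma varXB_neq0 : 1 - X != 0.
Proof. exact: transcendental_neq0 (transcendentalB (@transcendentalX K)). Qed.

Section Fixed.
Variables a b c : K.
Hypothesis st : standing a b c.

Let R k l m := Rcoef k l m a b c.
(** [Rcoef] hides its companion coefficient, which the determinant argument for [sig0] also needs;
    it is chosen here. *)
Let Q k l m := epsilon (inhabits 0) (fun Q => contig_rel k l m a b c Q (R k l m)).

Let contig_uniq k l m Q1 R1 Q2 R2 : contig_rel k l m a b c Q1 R1 ->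
  contig_rel k l m a b c Q2 R2 -> Q2 = Q1 /\ R2 = R1.
Proof. exact: (span_rel_uniq (hypF_free char0 st)). Qed.

Let relQR k l m : contig_rel k l m a b c (Q k l m) (R k l m).
Proof.
apply: (epsilon_spec (inhabits 0) (fun Q => contig_rel k l m a b c Q (R k l m))).
have [Q0 [R0 h]] := contig_rel_exists char0 st k l m.
have [|Q1 [h1 _]] := epsilon_spec (inhabits 0) (fun R : ratfun K =>
    exists Q, contig_rel k l m a b c Q R /\
      forall Q' R', contig_rel k l m a b c Q' R' -> Q' = Q /\ R' = R).
  by exists R0, Q0; split=> // Q' R'; apply: contig_uniq.
by exists Q1.
Qed.

Let F k l m := hypF (a + k%:~R) (b + l%:~R) (c + m%:~R).

Let rel_step (k l m k1 l1 m1 k2 l2 m2 : int) u v u1 v1 u2 v2 :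
  linp u v != 0 ->
  (forall n, pmulS (linp u v) (F k l m) n =
     pmulS (linp u1 v1) (F k1 l1 m1) n + pmulS (linp u2 v2) (F k2 l2 m2) n) ->
  (cstF u + cstF v * X) * Q k l m =
    (cstF u1 + cstF v1 * X) * Q k1 l1 m1 + (cstF u2 + cstF v2 * X) * Q k2 l2 m2 /\
  (cstF u + cstF v * X) * R k l m =
    (cstF u1 + cstF v1 * X) * R k1 l1 m1 + (cstF u2 + cstF v2 * X) * R k2 l2 m2.
Proof.
move=> p0 E; rewrite -!tofrac_linp.
have [] := contig_uniq (relQR k l m) (span_rel_comb p0 E (relQR k1 l1 m1) (relQR k2 l2 m2)).
have fp : FracField.tofrac (linp u v) != 0 by rewrite tofrac_eq0.
by move=> <- <-; rewrite ![FracField.tofrac (linp u v) * _]mulrC !mulfVK.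
Qed.

(** Lets the six relations be checked once, for a family [G] known only through the conclusion of
    [rel_step], instead of separately for [Q] and [R]. *)
Let both (P : (int -> int -> int -> ratfun K) -> Prop) :
  (forall G : int -> int -> int -> ratfun K,
     (forall (k l m k1 l1 m1 k2 l2 m2 : int) u v u1 v1 u2 v2, linp u v != 0 ->
       (forall n, pmulS (linp u v) (F k l m) n =
         pmulS (linp u1 v1) (F k1 l1 m1) n + pmulS (linp u2 v2) (F k2 l2 m2) n) ->
       (cstF u + cstF v * X) * G k l m =
       (cstF u1 + cstF v1 * X) * G k1 l1 m1 + (cstF u2 + cstF v2 * X) * G k2 l2 m2) ->
     P G) -> P Q /\ P R.
Proof.
move=> h; split; apply: h => k l m k1 l1 m1 k2 l2 m2 u v u1 v1 u2 v2 nz E.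
  by case: (rel_step nz E).
by case: (rel_step nz E).
Qed.

Lemma contiguous_coef :
  exists2 Q, contiguous (cstF a) (cstF b) (cstF c) X Q /\ Q 0 0 0 = 0 /\ Q 1 1 1 = 1 &
  contiguous (cstF a) (cstF b) (cstF c) X (fun k l m => Rcoef k l m a b c) /\
  Rcoef 0 0 0 a b c = 1 /\ Rcoef 1 1 1 a b c = 0.
Proof.
have [cQ cR] : contiguous (cstF a) (cstF b) (cstF c) X Q /\
    contiguous (cstF a) (cstF b) (cstF c) X R.
  apply: both => G step; apply: contiguous_linear => k l m /=.
  have [ha [hb [hca [hcb [hc _]]]]] := standing_shift k l m st.
  have a1 := notInt_neq0 1 ha; have b1 := notInt_neq0 1 hb.
  have nz1 : (1 : K) != 0 by rewrite oner_neq0.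
  have Fs k' l' m' : F k' l' m' = hypF (b + l'%:~R) (a + k'%:~R) (c + m'%:~R) by apply: hypF_swap.
  have two (y : K) (i : int) : y + (i + 2)%:~R = y + i%:~R + 2.
    by rewrite intrD addrA.
  have one (y : K) (i : int) : y + (i + 1)%:~R = y + i%:~R + 1.
    by rewrite intr_succ addrA.
  have mone (y : K) (i : int) : y + (i - 1)%:~R = y + i%:~R - 1.
    by rewrite intr_pred addrA.
  (* Each coefficient is folded into a single constant [cstF u], the shape that [step] expects. *)
  rewrite -!cstF_int -cstF1 -cstF0.
  rewrite -!cstFD -!cstFN -!cstFD -!cstFM
    -!cstFV -!cstFM.
  split; split; apply: step; rewrite ?linp_neq0 // => n.
  - by rewrite /F !one; apply: hyp_rel_a.
  - by rewrite /F two !one; apply: hyp_rel_a1.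
  - by rewrite !Fs !one; apply: hyp_rel_a.
  - by rewrite !Fs two !one; apply: hyp_rel_a1.
  - by rewrite /F mone !one; apply: hyp_rel_c.
  - by rewrite /F !one; apply: hyp_rel_c1.
have b0 : contig_rel 0 0 0 a b c 0 1.
  have := span_rel_base0 (hypF a b c) (hypF (a + 1) (b + 1) (c + 1)).
  by rewrite /contig_rel !addr0.
have b1 : contig_rel 1 1 1 a b c 1 0 := span_rel_base1 _ _.
have [Q0 R0] := contig_uniq (relQR 0 0 0) b0.
have [Q1 R1] := contig_uniq (relQR 1 1 1) b1.
by exists Q.
Qed.

End Fixed.

Lemma Rcoef_uniq (a b c : K) G : standing a b c ->
  contiguous (cstF a) (cstF b) (cstF c) X G -> G 0 0 0 = 1 -> G 1 1 1 = 0 ->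
  forall k l m, Rcoef k l m a b c = G k l m.
Proof.
move=> st sG G0 G1; have [_ _ [sR [R0 R1]]] := contiguous_coef st.
apply: (contiguous_uniq (cstF_standing st) varX_neq0 varXB_neq0 sR sG).
  by rewrite R0 G0.
by rewrite R1 G1.
Qed.

Lemma contiguous_fsubst (a b c : K) be : standing a b c -> transcendental be ->
  contiguous (cstF a) (cstF b) (cstF c) be (fun k l m => fsubst be (Rcoef k l m a b c)) /\
  fsubst be (Rcoef 0 0 0 a b c) = 1 /\ fsubst be (Rcoef 1 1 1 a b c) = 0.
Proof.
move=> st tr; have [_ _ [sR [R0 R1]]] := contiguous_coef st.
have [phi phiE] := fsubst_morph tr.
rewrite R0 R1 !phiE rmorph0 rmorph1; split=> //.
have := contiguous_rmorph phi sR.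
rewrite -!phiE fsubstX // !fsubst_cst // => -[h1 h2 h3 h4 h5 h6].
by split=> k l m; rewrite !phiE; [exact: h1|exact: h2|exact: h3|exact: h4|exact: h5|exact: h6].
Qed.

Definition sig0_factor (a b c : K) (k l m : int) : K :=
  poch (c + 1) (m - 1) * poch c (m - 1)
  / (poch (a + 1) (k - 1) * poch (b + 1) (l - 1) * poch (c - a) (m - k) * poch (c - b) (m - l)).

Lemma Rcoef_sig0 (a b c : K) k l m : standing a b c ->
  Rcoef k l m a b c = cstF (sig0_factor a b c k l m)
    * (-1) ^ (m - k - l) * X ^ (1 - m) * (1 - X) ^ (m + 1 - k - l)
    * Rcoef (2 - k) (2 - l) (2 - m) (a + (k - 1)%:~R) (b + (l - 1)%:~R) (c + (m - 1)%:~R).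
Proof.
move=> st; have st' := standing_shift (k - 1) (l - 1) (m - 1) st.
have [Q [sQ [Q0 Q1]] [sR [R0 R1]]] := contiguous_coef st.
have [Q' [sQ' [Q0' Q1']] [sR' [R0' R1']]] := contiguous_coef st'.
have E u i : cstF (u + i%:~R) = cstF u + i%:~R :> ratfun K.
  by rewrite cstFD cstF_int.
have fst' := cstF_standing st'; rewrite !E in sQ' sR' fst'.
rewrite (contiguous_reversal (cstF_standing st) varX_neq0 varXB_neq0 sR sQ R0 R1 Q0 Q1
  fst' sR' sQ' R0' R1' Q0' Q1').
congr (_ * _); rewrite /wronskian_factor /sig0_factor.
rewrite (_ : m - 1 - (k - 1) = m - k); last by ring.
rewrite (_ : m - 1 - (l - 1) = m - l); last by ring.
rewrite (_ : m - k - (l - 1) = m - k - l + 1); last by ring.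
rewrite (_ : m + 1 - k - l = m - k - l + 1); last by ring.
rewrite !(cstFM, cstFV) !cstF_poch !cstFB
  !cstFD cstF1 opprB.
(* The Wronskian at [(k - 1, l - 1, m - 1)] carries sign exponent [m - k - l + 1]; the minus sign of
   Cramer's rule removes the extra one. *)
rewrite [(-1) ^ (_ + 1)]expfzDr ?oppr_eq0 ?oner_neq0 // expr1z mulrN1 mulrN !mulNr opprK.
by [].
Qed.

Lemma transcendental_pfaff be : transcendental be -> @transcendental K (be / (be - 1)).
Proof.
move=> tr; rewrite (pfaff_mobius (transcendental_neq0 (transcendentalB tr))).
exact/transcendentalB/transcendentalV/transcendentalB.
Qed.

(** Up to sign and integer shifts, the generators permute the seven quantities of the standing
    assumption; here [a] and [c - a] are exchanged, and so are [c - a - b] and [a - b]. *)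
Lemma standing_pfaff (a b c : K) : standing a b c -> standing (c - a - 1) b c.
Proof.
move=> [ha [hb [hca [hcb [hc [hcab hab]]]]]].
have e1 : c - (c - a - 1) = a + 1%:~R by ring.
have e2 : c - (c - a - 1) - b = a - b + 1%:~R by ring.
have e3 : c - a - 1 - b = c - a - b + (-1)%:~R by ring.
split; first exact: (notIntD (-1) hca).
by repeat split; rewrite ?e2 ?e1 ?e3 //; apply: notIntD.
Qed.

Lemma standing_connection (a b c : K) : standing a b c -> standing a b (a + b + 1 - c).
Proof.
move=> [ha [hb [hca [hcb [hc [hcab hab]]]]]].
have e1 : a + b + 1 - c - a = - (c - b + (-1)%:~R) by ring.
have e2 : a + b + 1 - c - b = - (c - a + (-1)%:~R) by ring.
have e3 : a + b + 1 - c = - (c - a - b + (-1)%:~R) by ring.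
have e4 : a + b + 1 - c - a - b = - (c + (-1)%:~R) by ring.
by repeat split; rewrite ?e4 ?e1 ?e2 ?e3 //; apply/notIntN/notIntD.
Qed.

Lemma standing_swap (a b c : K) : standing a b c -> standing b a c.
Proof.
move=> [ha [hb [hca [hcb [hc [hcab hab]]]]]]; repeat split => //.
  by rewrite addrAC.
by rewrite -opprB; apply: notIntN.
Qed.

Lemma Rcoef_sig1 (a b c : K) k l m : standing a b c ->
  Rcoef k l m a b c =
    (1 - X) ^ (- l) * fsubst (X / (X - 1)) (Rcoef (m + 1 - k) l m (c - a - 1) b c).
Proof.
move=> st.
have [] := contiguous_fsubst (standing_pfaff st) (transcendental_pfaff (@transcendentalX K)).
rewrite !cstFB cstF1 => sH [H0 H1].
apply: (Rcoef_uniq st (contiguous_pfaff (cstF_standing st) varXB_neq0 sH)).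
  (* The transformed family starts at [H 1 0 0], which equals [H 0 0 0 = 1] because the other term
     contains [H 1 1 1 = 0]. *)
  have := contig_a sH 0 0 0; rewrite !add0r H0 H1 mulr0 addr0 => e.
  by rewrite oppr0 expr0z mul1r addr0 e.
by rewrite addrK H1 mulr0.
Qed.

Lemma Rcoef_sig2 (a b c : K) k l m : standing a b c ->
  Rcoef k l m a b c = cstF (connection_factor a b c k l m)
    * fsubst (1 - X) (Rcoef k l (k + l - m) a b (a + b + 1 - c)).
Proof.
move=> st.
have [] := contiguous_fsubst (standing_connection st) (transcendentalB (@transcendentalX K)).
rewrite !(cstFB, cstFD) cstF1 => sH [H0 H1].
rewrite (Rcoef_uniq st (contiguous_connection (cstF_standing st) varX_neq0 varXB_neq0 sH)).
- by rewrite /connection_factor !(cstFM, cstFV) !cstF_poch !cstFB.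
- by rewrite /connection_factor !subr0 !poch0 !mulr1 divr1 mul1r H0.
- by rewrite addrK H1 mulr0.
Qed.

Lemma Rcoef_sig3 (a b c : K) k l m : standing a b c -> Rcoef k l m a b c = Rcoef l k m b a c.
Proof.
move=> st; have [_ _ [sR [R0 R1]]] := contiguous_coef (standing_swap st).
exact: (Rcoef_uniq st (contiguous_swap sR)).
Qed.

End Coefficients.

(** * Symmetries at arbitrary points of S *)

(** A copy of [evalSx] over an abstract field, where [field] settles the identities between the six
    values. *)
Definition sx_val (F : fieldType) (x : F) (s : Sx) : F :=
  match s with
  | Sx_x => x | Sx_xx1 => x / (x - 1) | Sx_1mx => 1 - x
  | Sx_x1x => (x - 1) / x | Sx_inv => x^-1 | Sx_inv1mx => (1 - x)^-1
  end.

(** Exponents of [-1], [x] and [1 - x]: each of the six values is such a monomial, so powers picked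
    up at any point of S keep the form required by the theorem. *)
Definition sx_exponents (s : Sx) : int * int * int :=
  match s with
  | Sx_x => (0, 1, 0) | Sx_xx1 => (1, 1, -1) | Sx_1mx => (0, 0, 1)
  | Sx_x1x => (1, -1, 1) | Sx_inv => (0, -1, 0) | Sx_inv1mx => (0, 0, -1)
  end.

Section SxVal.
Variables (F : fieldType) (x : F).
Hypotheses (x0 : x != 0) (x1 : 1 - x != 0).
Let x1' : x - 1 != 0. Proof. by rewrite -oppr_eq0 opprB. Qed.

Lemma sx_val_div s : sx_val x s / (sx_val x s - 1) = sx_val x (sx_div s).
Proof.
have e1 : x + -1 * (x - 1) = 1 by ring.
have e2 : x - 1 + -1 * x = -1 by ring.
have e3 : 1 - x - 1 = - x by ring.
by case: s => //=; field;
  rewrite ?x0 ?x1 ?x1' ?e1 ?e2 ?e3 ?oppr_eq0 ?x0 ?oner_neq0.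
Qed.

Lemma sx_val_1m s : 1 - sx_val x s = sx_val x (sx_1m s).
Proof. by case: s => //=; field; rewrite ?x0 ?x1 ?x1'. Qed.

Lemma sx_val_monomial s :
  let: (e, i, j) := sx_exponents s in sx_val x s = (-1) ^ e * x ^ i * (1 - x) ^ j.
Proof.
have V (y : F) : y ^ (- 1 : int) = y^-1 by [].
by case: s; rewrite /= ?V ?expr0z ?expr1z; field; rewrite ?x0 ?x1 ?x1'.
Qed.
End SxVal.

Section Evaluation.
Variable K : fieldType.
Local Notation X := (varX K).

Lemma evalSx_div s : evalSx K s / (evalSx K s - 1) = evalSx K (sx_div s).
Proof. exact: (sx_val_div (varX_neq0 K) (varXB_neq0 K) s). Qed.

Lemma evalSx_1m s : 1 - evalSx K s = evalSx K (sx_1m s).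
Proof. exact: (sx_val_1m (varX_neq0 K) (varXB_neq0 K) s). Qed.

Lemma transcendental_evalSx s : transcendental (evalSx K s).
Proof.
have t1 := @transcendentalX K; have t2 := transcendentalB t1.
have t3 := transcendental_pfaff t1.
have t4 := transcendentalV t2; have t5 := transcendentalV t1.
have t6 : transcendental (evalSx K Sx_x1x) by rewrite -(evalSx_1m Sx_inv); apply: transcendentalB.
by case: s; [exact: t1|exact: t3|exact: t2|exact: t6|exact: t5|exact: t4].
Qed.

Section Fsubst.
Variable be : ratfun K.
Hypothesis tr : transcendental be.

Lemma fsubstM f g : fsubst be (f * g) = fsubst be f * fsubst be g.
Proof. by have [phi phiE] := fsubst_morph tr; rewrite !phiE rmorphM. Qed.

Lemma fsubst_varX_exp n : fsubst be (X ^ n) = be ^ n.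
Proof.
have [phi phiE] := fsubst_morph tr.
by rewrite phiE fmorphXz -phiE fsubstX.
Qed.

Lemma fsubst_1mX_exp n : fsubst be ((1 - X) ^ n) = (1 - be) ^ n.
Proof.
have [phi phiE] := fsubst_morph tr.
by rewrite phiE fmorphXz rmorphB rmorph1 -phiE fsubstX.
Qed.

Lemma fsubst_sign n : fsubst be ((-1) ^ n) = (-1) ^ n.
Proof.
have [phi phiE] := fsubst_morph tr.
by rewrite phiE fmorphXz rmorphN rmorph1.
Qed.

End Fsubst.

Variables a b c : K.

Lemma evalabcD u v : evalabc a b c (saddS u v) = evalabc a b c u + evalabc a b c v.
Proof. rewrite /evalabc /= !mulrzDr; ring. Qed.

Lemma evalabcN u : evalabc a b c (soppS u) = - evalabc a b c u.
Proof. rewrite /evalabc /= !mulrNz; ring. Qed.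

Lemma evalabc_const n : evalabc a b c (sconst n) = n%:~R.
Proof. by rewrite /evalabc /= !mulr0z !addr0. Qed.

Lemma evalabcA : evalabc a b c sA = a.
Proof. by rewrite /evalabc /= !mulr0z !addr0 add0r. Qed.

Lemma evalabcB : evalabc a b c sB = b.
Proof. by rewrite /evalabc /= !mulr0z addr0 !add0r. Qed.

Lemma evalabcC : evalabc a b c sC = c.
Proof. by rewrite /evalabc /= !mulr0z !add0r. Qed.

Definition standing_at (z : Spt) :=
  standing (evalabc a b c (s1 z)) (evalabc a b c (s2 z)) (evalabc a b c (s3 z)).

Definition evalabcE := (evalabcD, evalabcN, evalabc_const).

Lemma standing_at_sig i z : standing_at z -> standing_at (gen_sig i z).
Proof.
rewrite /standing_at; case: i => [|[|[|i]]] st /=; rewrite ?evalabcE.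
- exact: standing_shift.
- exact: standing_pfaff.
- exact: standing_connection.
- exact: standing_swap.
Qed.

Hypothesis char0 : has_pchar0 K.
Implicit Type z : Spt.

Lemma Rmap_sig0 z : standing_at z ->
  Rmap a b c z =
    cstF (sig0_factor (evalabc a b c (s1 z)) (evalabc a b c (s2 z)) (evalabc a b c (s3 z))
            (sk z) (sl z) (sm z))
    * (-1) ^ (sm z - sk z - sl z) * evalSx K (sx z) ^ (1 - sm z)
    * evalSx K (sx_1m (sx z)) ^ (sm z + 1 - sk z - sl z) * Rmap a b c (sig0 z).
Proof.
move=> st; have tr := transcendental_evalSx (sx z).
rewrite /Rmap (Rcoef_sig0 char0 _ _ _ st) !(fsubstM tr) (fsubst_cst _ tr) (fsubst_sign tr)
  (fsubst_varX_exp tr) (fsubst_1mX_exp tr) evalSx_1m.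
by rewrite /= !evalabcE.
Qed.

Lemma Rmap_sig1 z : standing_at z ->
  Rmap a b c z = evalSx K (sx_1m (sx z)) ^ (- sl z) * Rmap a b c (sig1 z).
Proof.
move=> st; have tr := transcendental_evalSx (sx z).
have tX := @transcendentalX K; have [phi phiE] := fsubst_morph tr.
rewrite /Rmap (Rcoef_sig1 char0 _ _ _ st) (fsubstM tr) (fsubst_1mX_exp tr) evalSx_1m.
rewrite (fsubst_comp _ tr (transcendental_pfaff tX)).
rewrite [fsubst (evalSx K (sx z)) (X / _)]phiE fmorph_div rmorphB rmorph1 -phiE (fsubstX tr).
by rewrite evalSx_div /= !evalabcE.
Qed.

Lemma Rmap_sig2 z : standing_at z ->
  Rmap a b c z =
    cstF (connection_factor (evalabc a b c (s1 z)) (evalabc a b c (s2 z))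
            (evalabc a b c (s3 z)) (sk z) (sl z) (sm z))
    * Rmap a b c (sig2 z).
Proof.
move=> st; have tr := transcendental_evalSx (sx z).
have tX := @transcendentalX K; have [phi phiE] := fsubst_morph tr.
rewrite /Rmap (Rcoef_sig2 char0 _ _ _ st) (fsubstM tr) (fsubst_cst _ tr).
rewrite (fsubst_comp _ tr (transcendentalB tX)).
rewrite [fsubst (evalSx K (sx z)) (1 - X)]phiE rmorphB rmorph1 -phiE (fsubstX tr).
by rewrite evalSx_1m /= !evalabcE.
Qed.

Lemma Rmap_sig3 z : standing_at z -> Rmap a b c z = Rmap a b c (sig3 z).
Proof. by move=> st; rewrite /Rmap (Rcoef_sig3 char0 _ _ _ st). Qed.

End Evaluation.

(** * Uniform prefactors along words in the generators *)

Definition monomial_factor (al : seq (Sabc * int)) (e i j : int) (K : fieldType) (a b c : K) :=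
  cstF (\prod_(p <- al) poch (evalabc a b c p.1) p.2)
  * (-1) ^ e * varX K ^ i * (1 - varX K) ^ j.

(** The data are chosen before the field and the parameters, matching the order of quantifiers in
    the theorem. *)
Definition monomial (z : Spt) (g : forall K : fieldType, K -> K -> K -> ratfun K) :=
  exists al e i j, forall (K : fieldType) (a b c : K),
    standing_at a b c z -> g K a b c = monomial_factor al e i j a b c.

Lemma monomial1 z : monomial z (fun K _ _ _ => 1).
Proof.
exists [::], 0, 0, 0 => K a b c _.
by rewrite /monomial_factor big_nil cstF1 !expr0z !mulr1.
Qed.

Lemma mul_monomial4 (F : fieldType) (u v w t u' v' w' t' : F) :
  u * v * w * t * (u' * v' * w' * t') = (u * u') * (v * v') * (w * w') * (t * t').
Proof. ring. Qed.

Lemma monomialM z g h : monomial z g -> monomial z h ->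
  monomial z (fun K a b c => g K a b c * h K a b c).
Proof.
move=> [al [e [i [j G]]]] [al' [e' [i' [j' H]]]].
exists (al ++ al'), (e + e'), (i + i'), (j + j') => K a b c st.
rewrite (G _ _ _ _ st) (H _ _ _ _ st) /monomial_factor big_cat cstFM.
rewrite (expfzDr _ _ (varX_neq0 K)) (expfzDr _ _ (varXB_neq0 K)) expfzDr.
  by rewrite mul_monomial4.
by rewrite oppr_eq0 oner_neq0.
Qed.

Lemma monomial_poch z u n : monomial z (fun K a b c => cstF (poch (evalabc a b c u) n)).
Proof.
exists [:: (u, n)], 0, 0, 0 => K a b c _.
by rewrite /monomial_factor big_seq1 !expr0z !mulr1.
Qed.

Lemma monomial_pochV z u n :
  (forall (K : fieldType) (a b c : K), standing_at a b c z -> notInt (evalabc a b c u)) ->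
  monomial z (fun K a b c => cstF (poch (evalabc a b c u) n)^-1).
Proof.
move=> h; have [al [e [i [j E]]]] := monomial_poch z (saddS u (sconst n)) (- n).
exists al, e, i, j => K a b c st.
by rewrite -(E _ _ _ _ st) pochV ?evalabcD ?evalabc_const //; apply: h.
Qed.

Lemma monomial_sign z n : monomial z (fun K _ _ _ => (-1) ^ n).
Proof.
exists [::], n, 0, 0 => K a b c _.
by rewrite /monomial_factor big_nil cstF1 !expr0z !mulr1 mul1r.
Qed.

Lemma monomial_evalSx z s n : monomial z (fun K _ _ _ => evalSx K s ^ n).
Proof.
have := fun K => sx_val_monomial (varX_neq0 K) (varXB_neq0 K) s.
case: (sx_exponents s) => -[e i] j E.
exists [::], (e * n), (i * n), (j * n) => K a b c _.
have -> : evalSx K s = (-1) ^ e * varX K ^ i * (1 - varX K) ^ j := E K.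
by rewrite /monomial_factor big_nil cstF1 mul1r !expfzMl !exprz_exp.
Qed.

Definition related z z' := exists2 g, monomial z g &
  forall (K : fieldType) (a b c : K), has_pchar0 K -> standing_at a b c z ->
  Rmap a b c z = g K a b c * Rmap a b c z'.

Lemma related_sig i z : related z (gen_sig i z).
Proof.
have h1 (K : fieldType) (a b c : K) : standing_at a b c z ->
    notInt (evalabc a b c (saddS (s1 z) (sconst 1))).
  by rewrite evalabcD evalabc_const => -[h _]; apply: notIntD.
have h2 (K : fieldType) (a b c : K) : standing_at a b c z ->
    notInt (evalabc a b c (saddS (s2 z) (sconst 1))).
  by rewrite evalabcD evalabc_const => -[_ [h _]]; apply: notIntD.
have h31 (K : fieldType) (a b c : K) : standing_at a b c z ->
    notInt (evalabc a b c (saddS (s3 z) (soppS (s1 z)))).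
  by rewrite evalabcD evalabcN => -[_ [_ [h _]]].
have h32 (K : fieldType) (a b c : K) : standing_at a b c z ->
    notInt (evalabc a b c (saddS (s3 z) (soppS (s2 z)))).
  by rewrite evalabcD evalabcN => -[_ [_ [_ [h _]]]].
case: i => [|[|[|i]]] /=.
- pose p u n := monomial_poch z u n.
  have pv := monomialM (monomialM (monomialM (monomial_pochV (sk z - 1) h1)
    (monomial_pochV (sl z - 1) h2)) (monomial_pochV (sm z - sk z) h31))
    (monomial_pochV (sm z - sl z) h32).
  eexists; first exact: (monomialM (monomialM (monomialM
    (monomialM (monomialM (p (saddS (s3 z) (sconst 1)) (sm z - 1)) (p (s3 z) (sm z - 1))) pv)
    (monomial_sign z (sm z - sk z - sl z))) (monomial_evalSx z (sx z) (1 - sm z)))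
    (monomial_evalSx z (sx_1m (sx z)) (sm z + 1 - sk z - sl z))).
  move=> K a b c char0 st /=; rewrite (Rmap_sig0 char0 st) /sig0_factor.
  by rewrite !evalabcE !(invfM, cstFM).
- eexists; first exact: (monomial_evalSx z (sx_1m (sx z)) (- sl z)).
  by move=> K a b c char0 st; rewrite (Rmap_sig1 char0 st).
- pose p u n := monomial_poch z u n.
  have pv := monomialM (monomial_pochV (sm z - sk z) h31) (monomial_pochV (sm z - sl z) h32).
  eexists; first exact: (monomialM (monomialM (p (s3 z) (sm z))
    (p (saddS (saddS (s3 z) (soppS (s1 z))) (soppS (s2 z))) (sm z - sk z - sl z))) pv).
  move=> K a b c char0 st /=; rewrite (Rmap_sig2 char0 st) /connection_factor.
  by rewrite !evalabcE !(invfM, cstFM).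
- exists (fun _ _ _ _ => 1); first exact: monomial1.
  by move=> K a b c char0 st; rewrite mul1r (Rmap_sig3 char0 st).
Qed.

Lemma related_word w z : related z (word_map w z).
Proof.
elim: w => [|i w [g gm gE]].
  by exists (fun _ _ _ _ => 1); [exact: monomial1|move=> *; rewrite mul1r].
have stw (K : fieldType) (a b c : K) : standing_at a b c z -> standing_at a b c (word_map w z).
  by move=> st; elim: w {g gm gE} => // j v IH; apply: standing_at_sig.
have [h [al [e [j' [j hm]]]] hE] := related_sig i (word_map w z).
exists (fun K a b c => g K a b c * h K a b c).
  (* The second prefactor is a monomial under the standing assumption at the intermediate point,
     which follows from that at [z]. *)
  by apply: monomialM gm _; exists al, e, j', j => K a b c st; apply/hm/stw.
by move=> K a b c char0 st; rewrite -mulrA -(hE _ _ _ _ char0 (stw _ _ _ _ st)) gE.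
Qed.

Lemma standing_at_z0 (K : fieldType) (a b c : K) k l m :
  standing a b c -> standing_at a b c (z0 k l m).
Proof. by rewrite /standing_at /= evalabcA evalabcB evalabcC. Qed.

Theorem theorem1p2 :
  (* G~ has 96 elements *)
  (exists e : 'I_96 -> (Spt -> Spt),
      injective e /\ forall f, Gt f <-> exists i, f = e i) /\
  (* symmetries under every sigma in G~ *)
  (forall (sig sinv : Spt -> Spt), Gt sig -> cancel sig sinv -> cancel sinv sig ->
   forall k l m : int,
   exists (al : seq (Sabc * int)) (ns1 ns2 ns3 : int),
   forall (K : fieldType), has_pchar0 K -> forall a b c : K, standing a b c ->
     Rmap a b c (z0 k l m) =
       cstF (\prod_(p <- al) poch (evalabc a b c p.1) p.2)
       * (-1) ^ ns1 * varX K ^ ns2 * (1 - varX K) ^ ns3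
       * actG sinv (Rmap a b c) (z0 k l m)) /\
  (* explicit formulas; each sigma~_i is an involution, so
     (sigma~_i R)(z) = R(sigma~_i z) *)
  (forall (K : fieldType), has_pchar0 K -> forall a b c : K, standing a b c ->
   forall k l m : int,
   let X := varX K in
   [/\ Rmap a b c (z0 k l m) =
         cstF (poch (c + 1) (m - 1) * poch c (m - 1)
               / (poch (a + 1) (k - 1) * poch (b + 1) (l - 1)
                  * poch (c - a) (m - k) * poch (c - b) (m - l)))
         * (-1) ^ (m - k - l) * X ^ (1 - m) * (1 - X) ^ (m + 1 - k - l)
         * Rmap a b c (sig0 (z0 k l m)),
       Rmap a b c (z0 k l m) = (1 - X) ^ (- l) * Rmap a b c (sig1 (z0 k l m)),
       Rmap a b c (z0 k l m) =
         cstF (poch c m * poch (c - a - b) (m - k - l)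
               / (poch (c - a) (m - k) * poch (c - b) (m - l)))
         * Rmap a b c (sig2 (z0 k l m)) &
       Rmap a b c (z0 k l m) = Rmap a b c (sig3 (z0 k l m))]).
Proof.
split; first exact: Gt_card.
split.
  move=> sig sinv Gsig sigK sinvK k l m.
  (* The action evaluates at the image under the inverse, so it is [sinv] that has to be written as
     a word. *)
  have [w ->] := (GtP sinv).1 (Gt_inv Gsig sigK sinvK).
  have [g [al [e [i [j gm]]]] gE] := related_word w (z0 k l m).
  exists al, e, i, j => K char0 a b c st; have st' := standing_at_z0 k l m st.
  by rewrite (gE _ _ _ _ char0 st') (gm _ _ _ _ st').
move=> K char0 a b c st k l m X; have st' := standing_at_z0 k l m st.
split.
- have := Rmap_sig0 char0 st'; rewrite [s1 _]/= [s2 _]/= [s3 _]/= evalabcA evalabcB evalabcC.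
  exact.
- exact: (Rmap_sig1 char0 st').
- have := Rmap_sig2 char0 st'; rewrite [s1 _]/= [s2 _]/= [s3 _]/= evalabcA evalabcB evalabcC.
  exact.
- exact: (Rmap_sig3 char0 st').
Qed.
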